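(* Let $\Omega \subseteq \mathbb{C}$ be an open set and $F\subseteq \mathbb{N}_0$ be a non-empty set. Then the set $S_{H_{F}^{\infty}(\Omega)}$ of functions in $H_{F}^{\infty}(\Omega)$ which are non-extendable is either empty, or a dense and $G_\delta$ subset of $H_{F}^{\infty}(\Omega)$ (with respect to its natural topology).
   Context: $\mathbb{N}_0=\{0,1,2,\dots\}$. For an open set $\Omega\subseteq\mathbb{C}$, $H(\Omega)$ is the set of holomorphic functions on $\Omega$. For non-empty $F\subseteq\mathbb{N}_0$, $H_F^\infty(\Omega)=\{f\in H(\Omega): f^{(l)} \text{ is bounded on } \Omega \text{ for all } l\in F\}$. Let $\Omega_i$, $i\in I$ ($I$ finite or $I=\mathbb{N}$), be the connected components of $\Omega$ and fix a point $z_i\in\Omega_i$ for each $i\in I$. The natural topology of $H_F^\infty(\Omega)$ is the one induced by the seminorms $\sup_{z\in\Omega}|f^{(l)}(z)|$, $l\in F$, and $|f^{(l)}(z_i)|$, $0\leqslant l<\min F$, $i\in I$. A holomorphic function $f:\Omega\to\mathbb{C}$ is called extendable (in the sense of Riemann surfaces) if there exist two open discs $D_1, D_2$ with $D_2\cap\Omega\neq\varnothing$, $D_2\cap\Omega^c\neq\varnothing$ and $D_1\subseteq\overline{D_1}\subseteq D_2\cap\Omega$, and a (bounded) holomorphic function $g:D_2\to\mathbb{C}$ such that $g|_{D_1}=f|_{D_1}$ (requiring $g$ to be bounded or not gives equivalent definitions). Otherwise $f$ is called non-extendable. *)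

(* Defs.v *)
From HB Require Import structures.
From mathcomp Require Import all_boot all_order all_algebra.
From mathcomp Require Import complex.
From mathcomp Require Import all_classical all_reals all_analysis.

Set Implicit Arguments.
Unset Strict Implicit.
Unset Printing Implicit Defensive.

Import Order.TTheory GRing.Theory Num.Theory.
Import numFieldNormedType.Exports.

Local Open Scope classical_set_scope.
Local Open Scope ring_scope.

(* The subset [A] of [V], with the topology induced by the family [P] of
   seminorms: [P] only needs to consist of functions whose restriction to the
   differences of elements of [A] is a seminorm. *)
Definition seminorm_space (R : realType) (V : zmodType) (A : set V)
  (P : set (V -> R)) : Type := set_type A.

Section SeminormSpace.
Context {R : realType} {V : zmodType} {A : set V} {P : set (V -> R)}.
Local Notation T := (seminorm_space A P).

HB.instance Definition _ := Choice.on T.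

Definition seminorm_open : set_system T := [set U |
  forall f : T, U f ->
    exists (J : set (V -> R)) (e : R),
      [/\ finite_set J, J `<=` P, 0 < e &
          forall g : T, (forall p, J p -> p (val g - val f) < e) -> U g]].

Let seminorm_openT : seminorm_open setT.
Proof. by move=> f _; exists set0, 1; split => //; exact: sub0set. Qed.

Let seminorm_openI : setI_closed seminorm_open.
Proof.
move=> U W oU oW f [/oU [J [e [finJ JP e0 JU]]] /oW [K [d [finK KP d0 KW]]]].
exists (J `|` K), (Num.min e d); split.
- by rewrite finite_setU.
- by move=> p [/JP|/KP].
- by rewrite lt_min e0.
- move=> g JKg; split.
  + by apply: JU => p Jp; have := JKg p (or_introl Jp); rewrite lt_min => /andP[].
  + by apply: KW => p Kp; have := JKg p (or_intror Kp); rewrite lt_min => /andP[].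
Qed.

Let seminorm_open_bigU (I : Type) (U : I -> set T) :
  (forall i, seminorm_open (U i)) -> seminorm_open (\bigcup_i U i).
Proof.
move=> oU f [i _ /oU[J [e [finJ JP e0 JU]]]].
by exists J, e; split=> // g /JU Ug; exists i.
Qed.

HB.instance Definition _ := isOpenTopological.Build T
  seminorm_openT seminorm_openI seminorm_open_bigU.

End SeminormSpace.

Section HolomorphicFunctions.
Context {R : realType}.
(* [R[i]^o] is [R[i]] as a normed module over itself, so that [derivable f z 1]
   and [derive1n] below refer to complex differentiation. *)
Local Notation C := (R[i]^o).

Definition holomorphic (Omega : set C) (f : C -> C) : Prop :=
  forall z, Omega z -> derivable f z 1.

(* A function defined on the open set [Omega] is represented by the total
   function extending it by [0]; this does not affect derivatives on [Omega]. *)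
Definition HFinf (Omega : set C) (F : set nat) : set (C -> C) := [set f |
  [/\ holomorphic Omega f,
      forall l, F l -> [bounded derive1n l f z | z in Omega] &
      forall z, ~ Omega z -> f z = 0]].

Definition min_set (F : set nat) : nat :=
  xget 0%N [set m | F m /\ forall k, F k -> (m <= k)%N].

Definition sup_seminorm (Omega : set C) (l : nat) (f : C -> C) : R :=
  sup [set complex.Re `|derive1n l f z| | z in Omega].

Definition point_seminorm (z : C) (l : nat) (f : C -> C) : R :=
  complex.Re `|derive1n l f z|.

Definition natural_seminorms (Omega : set C) (F I : set nat) (z : nat -> C) :
    set ((C -> C) -> R) :=
  [set sup_seminorm Omega l | l in F] `|`
  [set p | exists l i, [/\ (l < min_set F)%N, I i & p = point_seminorm (z i) l]].

Definition HFinf_space (Omega : set C) (F I : set nat) (z : nat -> C) :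
    topologicalType :=
  seminorm_space (HFinf Omega F) (natural_seminorms Omega F I z).

(* [Omega_ i], for [i] in [I], enumerates without repetition the connected
   components of [Omega]. *)
Definition components (Omega : set C) (I : set nat) (Omega_ : nat -> set C) :
    Prop :=
  (finite_set I \/ I = setT) /\
  set_bij I [set connected_component Omega x | x in Omega] Omega_.

Definition extendable (Omega : set C) (f : C -> C) : Prop :=
  exists (c1 c2 : C) (r1 r2 : R), let D1 := ball c1 r1%:C%C in
    let D2 := ball c2 r2%:C%C in
    [/\ 0 < r1 /\ 0 < r2,
        D2 `&` Omega !=set0,
        D2 `&` ~` Omega !=set0,
        D1 `<=` closure D1 /\ closure D1 `<=` D2 `&` Omega &
        exists2 g : C -> C, holomorphic D2 g & forall w, D1 w -> g w = f w].

Definition nonextendable_set (Omega : set C) (F I : set nat) (z : nat -> C) :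
    set (HFinf_space Omega F I z) :=
  [set f | ~ extendable Omega (\val (f : set_type (HFinf Omega F)))].

End HolomorphicFunctions.

Arguments nonextendable_set {R} Omega F I z _.

(* Main.v *)
Require Import Defs.
From mathcomp Require Import all_boot all_order all_algebra.
From mathcomp Require Import complex.
From mathcomp Require Import all_classical all_reals all_analysis.
From mathcomp Require Import borel_hierarchy.
From mathcomp Require Import ring lra zify.
Import Order.TTheory GRing.Theory Num.Theory.
Import numFieldNormedType.Exports.

(** A function [f] holomorphic on [Omega] is extendable iff for some Gaussian
    rational [c] in [Omega] and some rational [r] such that the disc [D(c, r)]
    is not contained in [Omega], the Taylor coefficients of [f] at [c] are
    [O(r^-n)].  Indeed, if [f = g] on [D1] and [g] is holomorphic on [D2], follow
    a segment of [D2] from [D1] to a point outside [Omega]: it leaves [Omega] at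
    some [p], the identity [f = g] persists near points [c] arbitrarily close to
    [p], and Cauchy's estimate for [g] bounds the Taylor coefficients of [f] at
    [c]; conversely the Taylor series of [f] at [c] is an extension.

    The Cauchy estimates, together with propagation along the connected
    components for the orders below [min F], show that each [f |-> f^(n)(c)] is
    continuous for the natural topology.  Hence the extendable functions are a
    countable union of closed sets [{f | forall n, |f^(n)(c)| <= n! M r^-n}].
    If [f0] is non-extendable, then for given [f] all but countably many [t]
    make [f + t f0] non-extendable: otherwise two parameters [s <> t] would
    share the same [c] and [r], and [(s - t) f0] would be extendable.

    As differentiability is only assumed pointwise, Taylor expansions are derived
    from Goursat's lemma, by Cauchy's integral over the boundary of a square. *)

Set Implicit Arguments.
Unset Strict Implicit.
Unset Printing Implicit Defensive.

Local Open Scope classical_set_scope.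
Local Open Scope ring_scope.
Local Open Scope complex_scope.

(** * Real-valued modulus and complex derivatives *)

Section ComplexModulus.
Context {R : realType}.
Local Notation C := (R[i]^o).
Implicit Types (z w h : C) (x y : R).

(** The norm of [C] takes its values in [R[i]], which is only partially ordered; its real part puts
    all estimates in [R], where [lra] applies. *)
Definition cabs z : R := complex.Re `|z|.

Lemma normE z : `|z| = (cabs z)%:C.
Proof. by rewrite /cabs normc_def. Qed.

Lemma cabsE z : cabs z = Num.sqrt ((complex.Re z) ^+ 2 + (complex.Im z) ^+ 2).
Proof. by rewrite /cabs normc_def. Qed.

Lemma cabs_ge0 z : 0 <= cabs z.
Proof. by rewrite cabsE sqrtr_ge0. Qed.

Lemma cabs0 : cabs 0 = 0.
Proof. by rewrite /cabs normr0. Qed.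

Lemma cabs_eq0 z : (cabs z == 0) = (z == 0).
Proof. by rewrite -(normr_eq0 z) normE -(inj_eq (@complexI R)). Qed.

Lemma cabs_gt0 z : (0 < cabs z) = (z != 0).
Proof. by rewrite lt_def cabs_ge0 andbT cabs_eq0. Qed.

Lemma cabs1 : cabs 1 = 1.
Proof. by rewrite /cabs normr1. Qed.

Lemma cabsi : cabs 'i = 1.
Proof. by rewrite cabsE /= expr0n/= add0r expr1n sqrtr1. Qed.

Lemma cabsM z w : cabs (z * w) = cabs z * cabs w.
Proof. by apply: (@complexI R); rewrite -normE normrM !normE rmorphM. Qed.

Lemma cabsD z w : cabs (z + w) <= cabs z + cabs w.
Proof. by rewrite -lecR -normE rmorphD/= -!normE ler_normD. Qed.

Lemma cabsN z : cabs (- z) = cabs z.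
Proof. by rewrite /cabs normrN. Qed.

Lemma cabsB z w : cabs (z - w) <= cabs z + cabs w.
Proof. by rewrite (le_trans (cabsD _ _))// cabsN. Qed.

Lemma cabsC z w : cabs (z - w) = cabs (w - z).
Proof. by rewrite -cabsN opprB. Qed.

Lemma cabs_tri z w v : cabs (z - v) <= cabs (z - w) + cabs (w - v).
Proof. by rewrite (le_trans _ (cabsD _ _))// addrA subrK. Qed.

Lemma cabsV z : cabs z^-1 = (cabs z)^-1.
Proof. by apply: (@complexI R); rewrite -normE normfV !normE fmorphV. Qed.

Lemma cabsX z n : cabs (z ^+ n) = cabs z ^+ n.
Proof. by apply: (@complexI R); rewrite -normE normrX !normE rmorphXn. Qed.

Lemma cabs_real x : cabs x%:C = `|x|.
Proof. by rewrite cabsE /= expr0n addr0 sqrtr_sqr. Qed.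

Lemma cabs_natr n : cabs n%:R = n%:R.
Proof. by rewrite /cabs normr_nat; have -> : n%:R = (n%:R : R)%:C by rewrite rmorph_nat. Qed.

Lemma cabs_Re z : `|complex.Re z| <= cabs z.
Proof. by rewrite -lecR -normE normc_ge_Re. Qed.

Lemma cabs_Im z : `|complex.Im z| <= cabs z.
Proof.
rewrite cabsE -[leLHS]ger0_norm// -sqrtr_sqr ler_wsqrtr//.
by rewrite real_normK ?num_real// lerDr sqr_ge0.
Qed.

Lemma cabs_le z : cabs z <= `|complex.Re z| + `|complex.Im z|.
Proof.
case: z => a b; have -> : a +i* b = a%:C + 'i * b%:C by rewrite [LHS]complexE.
by rewrite (le_trans (cabsD _ _))// cabsM cabsi mul1r !cabs_real/=
  !(mul0r, mulr0, subr0, addr0, add0r, mul1r).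
Qed.

Lemma cabsBl z w : cabs z - cabs w <= cabs (z - w).
Proof. by rewrite lerBlDr (le_trans _ (cabsD _ _))// subrK. Qed.

Lemma cabs_sum n (F : nat -> C) : cabs (\sum_(i < n) F i) <= \sum_(i < n) cabs (F i).
Proof.
elim: n => [|n IH]; first by rewrite !big_ord0 cabs0.
by rewrite !big_ord_recr/= (le_trans (cabsD _ _))// lerD2r.
Qed.

Lemma ball_cabs z x w : 0 < x -> ball z x%:C w <-> cabs (w - z) < x.
Proof. by move=> x0; rewrite -ball_normE /ball_/= normE ltcR cabsC. Qed.

Lemma gt0_complexP (e : R[i]) : 0 < e -> exists2 x, 0 < x & e = x%:C.
Proof.
case: e => a b; rewrite ltcE/= => /andP[/eqP-> a0]; by exists a.
Qed.

Lemma gtr0C x : (0 < x%:C) = (0 < x).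
Proof. by rewrite -ltcR. Qed.

Lemma nbhs_cabsP z (A : set C) :
  nbhs z A <-> exists2 x, 0 < x & forall w, cabs (w - z) < x -> A w.
Proof.
split.
  move=> /nbhs_ballP[e /= e0 eA].
  have [x x0 ex] := gt0_complexP e0; exists x => // w wz; apply: eA.
  by rewrite ex; exact/ball_cabs.
move=> [x x0 xA]; apply/nbhs_ballP; exists x%:C; first by rewrite /= gtr0C.
by move=> w /(ball_cabs _ _ x0) /xA.
Qed.

(** The difference quotient is cleared of its denominator, and the non-strict bound lets [h = 0] be
    included. *)
Definition cderiv (f : C -> C) z (d : C) := forall e, 0 < e -> exists2 t, 0 < t &
  forall h, cabs h < t -> cabs (f (z + h) - f z - d * h) <= e * cabs h.

Lemma is_deriveP (f : C -> C) z d : is_derive z 1 f d <-> cderiv f z d.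
Proof.
split.
  move=> [df dv] e e0.
  have : (fun h => h^-1 *: (f (h *: 1 + z) - f z)) @ 0^' --> d by rewrite -dv.
  move=> /cvgr_dist_lt /(_ e%:C); rewrite gtr0C => /(_ e0).
  move=> /nbhs_cabsP [t t0 H]; exists t => // h ht.
  have [->|h0] := eqVneq h 0.
    by rewrite addr0 subrr mulr0 subr0 cabs0 mulr0.
  have := H h; rewrite subr0 => /(_ ht h0).
  rewrite normE ltcR /= => /ltW He.
  have -> : f (z + h) - f z - d * h = - h * (d - h^-1 *: (f (h *: 1 + z) - f z)).
    have -> : h *: (1 : C) + z = z + h by rewrite addrC; congr (_ + _); exact: mulr1.
    have -> : h^-1 *: (f (z + h) - f z) = h^-1 * (f (z + h) - f z) by [].
    by field.
  by rewrite cabsM cabsN mulrC ler_wpM2r ?cabs_ge0.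
move=> fd.
suff cv : (fun h => h^-1 *: (f (h *: 1 + z) - f z)) @ 0^' --> d.
  split; first by apply/cvg_ex; exists d.
  exact/cvg_lim.
apply/cvgrPdist_lt => e /gt0_complexP[x x0 ->].
have [t t0 H] := fd (x / 2) (divr_gt0 x0 (ltr0Sn _ _)).
apply/nbhs_cabsP; exists t => // h; rewrite subr0 => ht h0.
have := H h ht; rewrite normE ltcR /=.
have -> : f (z + h) - f z - d * h = - h * (d - h^-1 *: (f (h *: 1 + z) - f z)).
  have -> : h *: (1 : C) + z = z + h by rewrite addrC; congr (_ + _); exact: mulr1.
  have -> : h^-1 *: (f (z + h) - f z) = h^-1 * (f (z + h) - f z) by [].
  by field.
rewrite cabsM cabsN mulrC ler_pM2r ?cabs_gt0// => H'; apply: le_lt_trans H' _.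
lra.
Qed.

Definition ccont (f : C -> C) z := forall e, 0 < e -> exists2 t, 0 < t &
  forall w, cabs (w - z) < t -> cabs (f w - f z) < e.

Lemma ccontP (f : C -> C) (z : C) : f @ nbhs z --> f z <-> ccont f z.
Proof.
split.
  move=> /cvgrPdist_lt H e e0; have := H e%:C; rewrite gtr0C => /(_ e0).
  move=> /nbhs_cabsP [t t0 K]; exists t => // w /K.
  by rewrite normE ltcR cabsC.
move=> H; apply/cvgrPdist_lt => e /gt0_complexP[x x0 ->].
have [t t0 K] := H _ x0; apply/nbhs_cabsP; exists t => // w /K.
by rewrite normE ltcR cabsC.
Qed.

Lemma cderiv_cont f z d : cderiv f z d -> ccont f z.
Proof.
move=> /is_deriveP [/derivable1_diffP/differentiable_continuous df _].
exact/ccontP.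
Qed.

End ComplexModulus.

(** * Integration of complex functions of a real variable *)

Section RealIntegral.
Context {R : realType}.
Implicit Types (u v : R -> R) (a b t : R).

Definition rint a b u : R := \int[lebesgue_measure]_(x in `[a, b]) u x.

(** Continuity is meant in [R], not relative to the interval, so it is two-sided even at [a] and
    [b]. *)
Definition rcont a b u := forall t, a <= t <= b -> {for t, continuous u}.

Lemma rcont_within a b u : rcont a b u -> {within `[a, b], continuous u}.
Proof.
move=> cu; apply: continuous_in_subspaceT => t; rewrite inE/= in_itv/=; exact: cu.
Qed.

Lemma rcont_int a b u : rcont a b u ->
  lebesgue_measure.-integrable `[a, b] (EFin \o u).
Proof.
move=> cu; apply: continuous_compact_integrable; first exact: segment_compact.
exact: rcont_within.
Qed.

Lemma rintD a b u v : rcont a b u -> rcont a b v ->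
  rint a b (fun x => u x + v x) = rint a b u + rint a b v.
Proof. by move=> cu cv; apply: RintegralD => //; exact: rcont_int. Qed.

Lemma rintZ a b k u : rcont a b u -> rint a b (fun x => k * u x) = k * rint a b u.
Proof. by move=> cu; apply: RintegralZl => //; exact: rcont_int. Qed.

Lemma rint_cst a b k : a <= b -> rint a b (fun=> k) = k * (b - a).
Proof.
rewrite /rint Rintegral_cst//= lebesgue_measure_itv/= lte_fin le_eqVlt.
by move=> /predU1P[->|->//]; rewrite ltxx subrr.
Qed.

Lemma cst_rcont a b k : rcont a b (fun=> k).
Proof. by move=> t _; exact: cvg_cst. Qed.

Lemma rint_le a b u v : rcont a b u -> rcont a b v ->
  (forall x, a <= x <= b -> u x <= v x) -> rint a b u <= rint a b v.
Proof.
move=> cu cv uv; apply: le_Rintegral => //; try exact: rcont_int.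
Qed.

Lemma eq_rint a b u v : (forall x, a <= x <= b -> u x = v x) ->
  rint a b u = rint a b v.
Proof.
by move=> uv; apply: eq_Rintegral => x; rewrite inE/= in_itv; exact: uv.
Qed.

Lemma rint_ge a b u m : a <= b -> rcont a b u ->
  (forall x, a <= x <= b -> m <= u x) -> m * (b - a) <= rint a b u.
Proof.
by move=> ab cu mu; rewrite -rint_cst// rint_le//; exact: cst_rcont.
Qed.

Lemma rint_norm a b u m : a <= b -> rcont a b u ->
  (forall x, a <= x <= b -> `|u x| <= m) -> `|rint a b u| <= m * (b - a).
Proof.
move=> ab cu um; rewrite ler_norml; apply/andP; split.
  by rewrite -mulNr rint_ge// => x /um; rewrite ler_norml => /andP[].
rewrite -rint_cst// rint_le//; first exact: cst_rcont.
by move=> x /um; rewrite ler_norml => /andP[].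
Qed.

Lemma rint_split c a b u : a <= c <= b -> rcont a b u ->
  rint a b u = rint a c u + rint c b u.
Proof.
move=> /andP[ac cb] cu.
have iu := rcont_int cu.
have := @Rintegral_itvB R u (BLeft a) (BRight b) c iu; rewrite !bnd_simp => /(_ ac cb) E.
rewrite /rint; apply/eqP; rewrite addrC -subr_eq; apply/eqP; rewrite E.
apply: Rintegral_itv_obnd_cbnd.
by apply: integrableS iu => //; apply: subset_itvr; rewrite bnd_simp.
Qed.

Lemma rint_prim a b u U : a <= b ->
  (forall t, a <= t <= b -> is_derive t 1 U (u t)) -> rcont a b u ->
  rint a b u = U b - U a.
Proof.
rewrite le_eqVlt => /predU1P[<- _ _|ab dU cu].
  by rewrite /rint set_itv1 Rintegral_set1 subrr.
rewrite /rint /Rintegral (@continuous_FTC2 _ _ U)//.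
- exact: rcont_within.
- have cU t : a <= t <= b -> {for t, continuous U}.
    move=> /dU [dUt _]; apply: differentiable_continuous.
    exact/derivable1_diffP.
  split.
  + move=> t; rewrite in_itv/= => /andP[/ltW at_ /ltW tb].
    by have [] := dU t; rewrite ?at_.
  + apply: cvg_at_right_filter; apply: cU; lra.
  + apply: cvg_at_left_filter; apply: cU; lra.
- move=> t; rewrite in_itv/= => /andP[/ltW at_ /ltW tb].
  by rewrite derive1E; have [_ ->] := dU t (introT andP (conj at_ tb)).
Qed.

End RealIntegral.

(** * Complex-valued integrands, by real and imaginary parts *)

Section ComplexIntegral.
Context {R : realType}.
Local Notation C := (R[i]^o).
Implicit Types (f g F : R -> C) (a b t : R).

Definition cint a b f : C := rint a b (@complex.Re R \o f) +i* rint a b (@complex.Im R \o f).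

Definition cconti a b f := forall t, a <= t <= b ->
  forall e, 0 < e -> exists2 d, 0 < d & forall s, `|s - t| < d -> cabs (f s - f t) < e.

Lemma cReB (x y : C) : complex.Re (x - y) = complex.Re x - complex.Re y.
Proof. by case: x y => ? ? []. Qed.
Lemma cImB (x y : C) : complex.Im (x - y) = complex.Im x - complex.Im y.
Proof. by case: x y => ? ? []. Qed.
Lemma cReD (x y : C) : complex.Re (x + y) = complex.Re x + complex.Re y.
Proof. by case: x y => ? ? []. Qed.
Lemma cImD (x y : C) : complex.Im (x + y) = complex.Im x + complex.Im y.
Proof. by case: x y => ? ? []. Qed.
Lemma cReM (x y : C) : complex.Re (x * y) = 
  complex.Re x * complex.Re y - complex.Im x * complex.Im y.
Proof. by case: x y => ? ? []. Qed.
Lemma cImM (x y : C) : complex.Im (x * y) = 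
  complex.Re x * complex.Im y + complex.Im x * complex.Re y.
Proof. by case: x y => ? ? []. Qed.
Lemma eq_ReIm (x y : C) : complex.Re x = complex.Re y -> complex.Im x = complex.Im y ->
  x = y.
Proof. by case: x y => ? ? [] ? ? /= -> ->. Qed.

Lemma near_dist (t d : R) : 0 < d -> \forall s \near t, `|s - t| < d.
Proof.
by move=> d0; apply/nbhs_ballP; exists d => // s; rewrite /ball/= distrC.
Qed.

Lemma cconti_Re a b f : cconti a b f -> rcont a b (@complex.Re R \o f).
Proof.
move=> cf t /cf H; apply/cvgrPdist_lt => e /H [d d0 K].
near=> s; rewrite /= -cReB (le_lt_trans (cabs_Re _))// cabsC; apply: K.
by near: s; exact: near_dist.
Unshelve. all: by end_near. Qed.

Lemma cconti_Im a b f : cconti a b f -> rcont a b (@complex.Im R \o f).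
Proof.
move=> cf t /cf H; apply/cvgrPdist_lt => e /H [d d0 K].
near=> s; rewrite /= -cImB (le_lt_trans (cabs_Im _))// cabsC; apply: K.
by near: s; exact: near_dist.
Unshelve. all: by end_near. Qed.

Lemma eq_cint a b f g : (forall x, a <= x <= b -> f x = g x) ->
  cint a b f = cint a b g.
Proof.
by move=> fg; congr (_ +i* _); apply: eq_rint => x /fg /= ->.
Qed.

Lemma cintD a b f g : cconti a b f -> cconti a b g ->
  cint a b (fun x => f x + g x) = cint a b f + cint a b g.
Proof.
move=> cf cg; apply: eq_ReIm; rewrite ?cReD ?cImD /= -rintD;
  try exact: cconti_Re; try exact: cconti_Im;
  by apply: eq_rint => x _ /=; rewrite ?cReD ?cImD.
Qed.

Lemma cintZ a b (k : C) f : cconti a b f ->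
  cint a b (fun x => k * f x) = k * cint a b f.
Proof.
move=> cf; have [cr ci] := (cconti_Re cf, cconti_Im cf).
have cZ (l : R) u : rcont a b u -> rcont a b (fun x => l * u x).
  by move=> cu t /cu; exact: cvgMr.
by apply: eq_ReIm; rewrite ?cReM ?cImM /= -?mulNr -!rintZ// -rintD; do ?[exact: cZ];
  apply: eq_rint => x _ /=; rewrite ?cReM ?cImM ?mulNr.
Qed.

(** The factor 2 comes from bounding the real and the imaginary part separately. *)
Lemma cint_bound a b f M : a <= b -> cconti a b f ->
  (forall x, a <= x <= b -> cabs (f x) <= M) -> cabs (cint a b f) <= 2 * M * (b - a).
Proof.
move=> ab cf fM; rewrite (le_trans (cabs_le _))//= -mulrA mulr2n mulrDl mul1r.
apply: lerD; apply: rint_norm => //.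
- exact: cconti_Re.
- by move=> x /fM; apply: le_trans; exact: cabs_Re.
- exact: cconti_Im.
- by move=> x /fM; apply: le_trans; exact: cabs_Im.
Qed.

Lemma cint_split c a b f : a <= c <= b -> cconti a b f ->
  cint a b f = cint a c f + cint c b f.
Proof.
move=> acb cf; apply: eq_ReIm; rewrite ?cReD ?cImD /= -rint_split//.
- exact: cconti_Re.
- exact: cconti_Im.
Qed.

(** The chain rule along [t |-> p + t v] brings the factor [v]; the real fundamental theorem of
    calculus then applies to the real and imaginary parts. *)
Lemma cint_prim a b (F : C -> C) (f : R -> C) (p v : C) : a <= b -> cconti a b f ->
  (forall t, a <= t <= b -> exists2 d, cderiv F (p + t%:C * v) d & f t = d * v) ->
  cint a b f = F (p + b%:C * v) - F (p + a%:C * v).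
Proof.
move=> ab cf dF.
have K t : a <= t <= b -> forall e, 0 < e -> exists2 d, 0 < d & forall h, `|h| < d ->
    cabs (F (p + (t + h)%:C * v) - F (p + t%:C * v) - h%:C * f t) <= e * `|h|.
  move=> /dF [d Hd ->] e e0.
  (* Dividing by [1 + cabs v] rather than [cabs v] allows [v = 0]. *)
  have [r r0 H] := Hd (e / (1 + cabs v)) (divr_gt0 e0 (ltr_wpDr (cabs_ge0 _) ltr01)).
  exists (r / (1 + cabs v)); first by rewrite divr_gt0// ltr_wpDr// cabs_ge0.
  move=> h hr.
  have v1 : 0 < 1 + cabs v by rewrite ltr_wpDr// cabs_ge0.
  have hv : cabs (h%:C * v) <= `|h| * (1 + cabs v).
    by rewrite cabsM cabs_real ler_wpM2l// lerDr.
  have hvr : cabs (h%:C * v) < r.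
    by rewrite (le_lt_trans hv)// -ltr_pdivlMr.
  have := H _ hvr.
  have -> : p + t%:C * v + h%:C * v = p + (t + h)%:C * v by rewrite rmorphD/= mulrDl addrA.
  have -> : d * (h%:C * v) = h%:C * (d * v) by ring.
  move=> /le_trans; apply.
  by rewrite -mulrA (ler_wpM2l (ltW e0))// ler_pdivrMl// [leRHS]mulrC.
(* [G] stands for the real or the imaginary part: compatible with differences and real factors, and
   bounded by the modulus. *)
have D (G : C -> R) (GB : forall x y, G (x - y) = G x - G y)
   (GZ : forall k x, G (k%:C * x) = k * G x) (Gn : forall x, `|G x| <= cabs x) t :
   a <= t <= b -> is_derive t 1 (fun t => G (F (p + t%:C * v))) (G (f t)).
  move=> /K H.
  suff cv : (fun h => h^-1 *: (G (F (p + (h *: 1 + t)%:C * v)) - G (F (p + t%:C * v))))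
      @ 0^' --> G (f t).
    by split; [apply/cvg_ex; exists (G (f t)) | exact/cvg_lim].
  apply/cvgrPdist_lt => e e0.
  have [d d0 Hd] := H (e / 2) (divr_gt0 e0 (ltr0Sn _ _)).
  near=> h.
  have h0 : h != 0 by near: h; exact: nbhs_dnbhs_neq.
  have hd : `|h| < d.
    near: h; apply/nbhs_ballP; exists d => // h /=.
    by rewrite /ball/= sub0r normrN.
  have := Hd h hd => Hh.
  rewrite -GB.
  have -> : h *: 1 + t = t + h by rewrite addrC; congr (_ + _); exact: mulr1.
  set A := F _ - F _ in Hh *; clearbody A.
  have -> : h^-1 *: G A = G (h^-1%:C * A) by rewrite GZ.
  rewrite -GB.
  rewrite (le_lt_trans (Gn _))//.
  have -> : f t - h^-1%:C * A = - h^-1%:C * (A - h%:C * f t).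
    by rewrite mulNr mulrBr mulrA -rmorphM/= mulVf// mul1r opprB.
  rewrite cabsM cabsN cabs_real normfV mulrC ltr_pdivrMr ?normr_gt0//.
  rewrite (le_lt_trans Hh)// ltr_pM2r ?normr_gt0//; lra.
apply: eq_ReIm; rewrite ?cReB ?cImB /=.
- apply: (@rint_prim R a b _ (fun t => complex.Re (F (p + t%:C * v))) ab).
  + by move=> t; apply: D; [exact: cReB| by move=> k [] ? ?/=; rewrite mul0r subr0|exact: cabs_Re].
  + exact: cconti_Re.
- apply: (@rint_prim R a b _ (fun t => complex.Im (F (p + t%:C * v))) ab).
  + by move=> t; apply: D; [exact: cImB| by move=> k [] ? ?/=; rewrite mul0r addr0|exact: cabs_Im].
  + exact: cconti_Im.
Unshelve. all: by end_near. Qed.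

End ComplexIntegral.

(** * Integrals over the boundary of a rectangle *)

Section Rectangles.
Context {R : realType}.
Local Notation C := (R[i]^o).
Implicit Types (f g F : C -> C) (a b c d t M : R) (z p v : C).

(** The contour integral along [t |-> p + t v]; the factor [v] is the velocity of the path. The
    sides of rectangles have [v = 1] or [v = 'i], whence the hypothesis [cabs v = 1] below. *)
Definition line v p a b f : C := v * cint a b (fun t => f (p + t%:C * v)).

Lemma line_cconti f v p a b : cabs v = 1 ->
  (forall t, a <= t <= b -> ccont f (p + t%:C * v)) ->
  cconti a b (fun t => f (p + t%:C * v)).
Proof.
move=> v1 cf t /cf H e /H [d d0 K]; exists d => // s sd; apply: K.
by rewrite opprD addrACA subrr add0r -mulrBl -rmorphB/= cabsM cabs_real v1 mulr1.
Qed.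

Lemma lineD v p a b f g : cabs v = 1 ->
  (forall t, a <= t <= b -> ccont f (p + t%:C * v)) ->
  (forall t, a <= t <= b -> ccont g (p + t%:C * v)) ->
  line v p a b (fun z => f z + g z) = line v p a b f + line v p a b g.
Proof.
by move=> v1 cf cg; rewrite /line (cintD (line_cconti v1 cf) (line_cconti v1 cg)) mulrDr.
Qed.

Lemma lineZ v p a b (k : C) f : cabs v = 1 ->
  (forall t, a <= t <= b -> ccont f (p + t%:C * v)) ->
  line v p a b (fun z => k * f z) = k * line v p a b f.
Proof.
by move=> v1 cf; rewrite /line (cintZ k (line_cconti v1 cf)) mulrCA.
Qed.

Lemma line_split m v p a b f : cabs v = 1 -> a <= m <= b ->
  (forall t, a <= t <= b -> ccont f (p + t%:C * v)) ->
  line v p a b f = line v p a m f + line v p m b f.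
Proof.
move=> v1 amb cf; rewrite /line -mulrDr (cint_split amb)//; exact: line_cconti.
Qed.

Lemma line_bound v p a b f M : cabs v = 1 -> a <= b ->
  (forall t, a <= t <= b -> ccont f (p + t%:C * v)) ->
  (forall t, a <= t <= b -> cabs (f (p + t%:C * v)) <= M) ->
  cabs (line v p a b f) <= 2 * M * (b - a).
Proof.
move=> v1 ab cf fM; rewrite cabsM v1 mul1r cint_bound//; exact: line_cconti.
Qed.

Lemma line_prim v p a b F f : cabs v = 1 -> a <= b ->
  (forall t, a <= t <= b -> ccont f (p + t%:C * v)) ->
  (forall t, a <= t <= b -> cderiv F (p + t%:C * v) (f (p + t%:C * v))) ->
  line v p a b f = F (p + b%:C * v) - F (p + a%:C * v).
Proof.
move=> v1 ab cf dF; rewrite /line -cintZ; last exact: line_cconti.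
rewrite (@cint_prim _ _ _ F _ p v)//.
  move=> t tab e e0; have [d d0 K] := line_cconti v1 cf tab e0.
  by exists d => // s /K; rewrite -mulrBr cabsM v1 mul1r.
by move=> t tab; exists (f (p + t%:C * v)); [exact: dF|rewrite mulrC].
Qed.

Lemma eq_line v p a b f g :
  (forall t, a <= t <= b -> f (p + t%:C * v) = g (p + t%:C * v)) ->
  line v p a b f = line v p a b g.
Proof. by move=> fg; rewrite /line (eq_cint fg). Qed.

Definition inrect a b c d z := 
  (a <= complex.Re z <= b) && (c <= complex.Im z <= d).

Definition bdrect a b c d z := inrect a b c d z /\
  [\/ complex.Re z = a, complex.Re z = b, complex.Im z = c | complex.Im z = d].

(** The boundary is run counterclockwise: bottom and right sides count positively, top and left
    sides negatively. The base points lie on the axes, so that the parameter is the moving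
    coordinate itself. *)
Definition rect f a b c d : C :=
  line 1 (0 +i* c) a b f + line 'i (b +i* 0) c d f
  - line 1 (0 +i* d) a b f - line 'i (a +i* 0) c d f.

Lemma hpoint c t : (0 +i* c) + t%:C * 1 = t +i* c :> C.
Proof. by rewrite mulr1; apply: eq_ReIm; rewrite /= ?add0r ?addr0. Qed.

Lemma vpoint a t : (a +i* 0) + t%:C * 'i = a +i* t :> C.
Proof. by apply: eq_ReIm; rewrite /= !(mulr0, mul0r, mulr1, add0r, addr0, subr0). Qed.

(** Turns a property of boundary points into the four parametrised forms that the lemmas on [line]
    expect. *)
Lemma rect_sides a b c d (P : C -> Prop) : a <= b -> c <= d ->
  (forall z, bdrect a b c d z -> P z) ->
  [/\ forall t, a <= t <= b -> P (0 +i* c + t%:C * 1),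
      forall t, c <= t <= d -> P (b +i* 0 + t%:C * 'i),
      forall t, a <= t <= b -> P (0 +i* d + t%:C * 1) &
      forall t, c <= t <= d -> P (a +i* 0 + t%:C * 'i)].
Proof.
move=> ab cd HP; split=> t ht; rewrite ?hpoint ?vpoint; apply: HP; split;
  rewrite /inrect /= ?ht ?lexx ?ab ?cd//.
- exact: Or43.
- exact: Or42.
- exact: Or44.
- exact: Or41.
Qed.

Section boundary.
Variables a b c d : R.
Hypotheses (ab : a <= b) (cd : c <= d).

Lemma rectD f g : (forall z, bdrect a b c d z -> ccont f z) ->
  (forall z, bdrect a b c d z -> ccont g z) ->
  rect (fun z => f z + g z) a b c d = rect f a b c d + rect g a b c d.
Proof.
move=> /(rect_sides ab cd)[f1 f2 f3 f4] /(rect_sides ab cd)[g1 g2 g3 g4].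
by rewrite /rect !lineD ?cabs1 ?cabsi//; do !move: (line _ _ _ _ _) => ?; ring.
Qed.

Lemma rectZ (k : C) f : (forall z, bdrect a b c d z -> ccont f z) ->
  rect (fun z => k * f z) a b c d = k * rect f a b c d.
Proof.
move=> /(rect_sides ab cd)[f1 f2 f3 f4].
by rewrite /rect !lineZ ?cabs1 ?cabsi//; do !move: (line _ _ _ _ _) => ?; ring.
Qed.

Lemma eq_rect f g : (forall z, bdrect a b c d z -> f z = g z) ->
  rect f a b c d = rect g a b c d.
Proof.
move=> /(rect_sides ab cd)[f1 f2 f3 f4].
by rewrite /rect (eq_line f1) (eq_line f2) (eq_line f3) (eq_line f4).
Qed.

Lemma rect_bound f M : (forall z, bdrect a b c d z -> ccont f z) ->
  (forall z, bdrect a b c d z -> cabs (f z) <= M) ->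
  cabs (rect f a b c d) <= 4 * M * ((b - a) + (d - c)).
Proof.
move=> /(rect_sides ab cd)[f1 f2 f3 f4] /(rect_sides ab cd)[m1 m2 m3 m4].
have l1 := line_bound cabs1 ab f1 m1.
have l2 := line_bound (@cabsi R) cd f2 m2.
have l3 := line_bound cabs1 ab f3 m3.
have l4 := line_bound (@cabsi R) cd f4 m4.
rewrite /rect; move: l1 l2 l3 l4; do !move: (line _ _ _ _ _) => ?.
move=> l1 l2 l3 l4; rewrite (le_trans (cabsB _ _))//.
apply: le_trans (lerD (le_trans (cabsB _ _) (lerD (cabsD _ _) (lexx _))) (lexx _)) _.
by move: l1 l2 l3 l4; do !move: (cabs _) => ?; lra.
Qed.

(** Each side gives a difference of two corner values of [F], and these cancel around the
    boundary. *)
Lemma rect_prim F f : (forall z, bdrect a b c d z -> ccont f z) ->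
  (forall z, bdrect a b c d z -> cderiv F z (f z)) -> rect f a b c d = 0.
Proof.
move=> /(rect_sides ab cd)[f1 f2 f3 f4] /(rect_sides ab cd)[g1 g2 g3 g4].
rewrite /rect (line_prim cabs1 ab f1 g1) (line_prim cabs1 ab f3 g3).
rewrite (line_prim (@cabsi R) cd f2 g2) (line_prim (@cabsi R) cd f4 g4).
by rewrite !hpoint !vpoint; ring.
Qed.

End boundary.

(** The cut is run twice, in opposite directions. *)
Lemma rect_splitx m a b c d f : a <= m <= b -> c <= d ->
  (forall z, inrect a b c d z -> ccont f z) ->
  rect f a b c d = rect f a m c d + rect f m b c d.
Proof.
move=> amb cd cf; have /andP[am mb] := amb; rewrite /rect !(line_split cabs1 amb).
- by do !move: (line _ _ _ _ _) => ?; ring.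
- by move=> t /andP[ta tb]; apply: cf; rewrite hpoint /inrect/= ta tb cd lexx.
- by move=> t /andP[ta tb]; apply: cf; rewrite hpoint /inrect/= ta tb cd lexx.
Qed.

Lemma rect_splity m a b c d f : a <= b -> c <= m <= d ->
  (forall z, inrect a b c d z -> ccont f z) ->
  rect f a b c d = rect f a b c m + rect f a b m d.
Proof.
move=> ab cmd cf; have /andP[cm md] := cmd; rewrite /rect !(line_split (@cabsi R) cmd).
- by do !move: (line _ _ _ _ _) => ?; ring.
- by move=> t /andP[ta tb]; apply: cf; rewrite vpoint /inrect/= ta tb ab lexx.
- by move=> t /andP[ta tb]; apply: cf; rewrite vpoint /inrect/= ta tb ab lexx.
Qed.

End Rectangles.

(** * Rectangles shrinking to a point *)

Section Bisection.
Context {R : realType}.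
Local Notation C := (R[i]^o).
Implicit Types (f g F : C -> C) (a b c d t M : R) (z p v : C).

(** [P a c u v] speaks of the rectangle with lower left corner [a +i* c] and sides [u], [v].
    Choosing again and again a quarter that keeps [P] yields nested rectangles with a common point.
    This compactness principle serves both Goursat's lemma and the boundedness of continuous
    functions. *)
Lemma bisection (P : R -> R -> R -> R -> Prop) a c (u v : R) : 0 < u -> 0 < v ->
  (forall a c (u v : R), 0 < u -> 0 < v -> P a c (2 * u) (2 * v) ->
    exists s t : bool, P (a + s%:R * u) (c + t%:R * v) u v) ->
  P a c u v ->
  exists x y, inrect a (a + u) c (c + v) (x +i* y) /\
    forall e, 0 < e -> exists a' c' k,
      [/\ 0 < k <= 1 /\ k * (u + v) < e, P a' c' (k * u) (k * v),
        inrect a' (a' + k * u) c' (c' + k * v) (x +i* y) &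
        [/\ a <= a', a' + k * u <= a + u, c <= c' & c' + k * v <= c + v]].
Proof.
move=> u0 v0 step P0.
pose h n : R := 2^-1 ^+ n.
have h0 n : 0 < h n by rewrite exprn_gt0.
have hS n : h n = 2 * h n.+1 by rewrite /h exprS; field.
pose Q n (q : R * R) := P q.1 q.2 (h n * u) (h n * v).
have next n q : Q n q -> exists st : bool * bool,
    Q n.+1 (q.1 + st.1%:R * (h n.+1 * u), q.2 + st.2%:R * (h n.+1 * v)).
  rewrite /Q hS -!mulrA => /step[||s [t st]]; rewrite ?mulr_gt0//.
  by exists (s, t).
(* The default of [xget] is not reached where [Q] holds; the monotonicity below is true whichever
   quarter is chosen. *)
pose nx n q : R * R := 
  let st := xget (false, false) [set st : bool * bool | 
    Q n.+1 (q.1 + st.1%:R * (h n.+1 * u), q.2 + st.2%:R * (h n.+1 * v))] in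
  (q.1 + st.1%:R * (h n.+1 * u), q.2 + st.2%:R * (h n.+1 * v)).
pose fix q n : R * R := if n is n'.+1 then nx n' (q n') else (a, c).
have Qq n : Q n (q n).
  elim: n => [|n IH]; first by rewrite /Q/= /h expr0 !mul1r.
  by have [st Hst] := next _ _ IH; rewrite /= /nx; case: xgetP => [? _ //|/(_ st)].
have mono1 n : (q n).1 <= (q n.+1).1 /\ (q n.+1).1 + h n.+1 * u <= (q n).1 + h n * u.
  rewrite /= /nx /=; set st := xget _ _; rewrite (hS n).
  have : 0 < h n.+1 * u by rewrite mulr_gt0.
  by case: st.1 => /=; rewrite ?mulr1n ?mulr0n ?mul1r ?mul0r ?addr0; split; lra.
have mono2 n : (q n).2 <= (q n.+1).2 /\ (q n.+1).2 + h n.+1 * v <= (q n).2 + h n * v.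
  rewrite /= /nx /=; set st := xget _ _; rewrite (hS n).
  have : 0 < h n.+1 * v by rewrite mulr_gt0.
  by case: st.2 => /=; rewrite ?mulr1n ?mulr0n ?mul1r ?mul0r ?addr0; split; lra.
(* Nested intervals share the supremum of their left ends. *)
have nested (s : nat -> R) w : 0 < w ->
   (forall n, s n <= s n.+1 /\ s n.+1 + h n.+1 * w <= s n + h n * w) ->
   exists x, forall n, s n <= x <= s n + h n * w.
  move=> w0 ms.
  have up n m : s n <= s (n + m)%N /\ s (n + m)%N + h (n + m)%N * w <= s n + h n * w.
    elim: m => [|m [IH1 IH2]]; first by rewrite addn0.
    have [] := ms (n + m)%N; rewrite -addnS; lra.
  have le n m : s n <= s m + h m * w.
    have hw k : 0 < h k * w by rewrite mulr_gt0.
    have [nm|/ltnW mn] := leqP n m.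
      by have [] := up n (m - n)%N; rewrite subnKC//; have := hw m; lra.
    by have [_] := up m (n - m)%N; rewrite subnKC//; have := hw n; lra.
  exists (sup (range s)) => n; apply/andP; split.
    apply: ub_le_sup; last by exists n.
    by exists (s n + h n * w) => _ [m _ <-].
  by apply: ge_sup; [exists (s 0), 0|move=> _ [m _ <-]].
have [x Hx] := nested _ _ u0 mono1; have [y Hy] := nested _ _ v0 mono2.
exists x, y; split.
  by move: (Hx 0) (Hy 0); rewrite /inrect /= /h expr0 !mul1r => -> ->.
move=> e e0.
have bnd n : a <= (q n).1 /\ (q n).1 + h n * u <= a + u.
  elim: n => [|n [I1 I2]]; first by rewrite /h expr0 mul1r.
  by have [] := mono1 n; split; lra.
have bnd2 n : c <= (q n).2 /\ (q n).2 + h n * v <= c + v.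
  elim: n => [|n [I1 I2]]; first by rewrite /h expr0 mul1r.
  by have [] := mono2 n; split; lra.
have uv0 : 0 < u + v by rewrite addr_gt0.
have [n hn] : exists n, h n < e / (u + v).
  have cv : h @ \oo --> (0 : R).
    by apply: cvg_expr; rewrite ger0_norm// invf_lt1// ltr1n.
  move/cvgrPdist_lt: cv => /(_ _ (divr_gt0 e0 uv0)) [n _ /(_ n (leqnn n))].
  by rewrite sub0r normrN ger0_norm ?ltW//; exists n.
exists (q n).1, (q n).2, (h n); split.
- rewrite -ltr_pdivlMr//; split=> //; rewrite h0/=.
  by rewrite exprn_ile1// invf_le1// ler1n.
- exact: Qq.
- by rewrite /inrect/= Hx Hy.
- by have [] := bnd n; have [] := bnd2 n.
Qed.

End Bisection.

(** * Goursat's lemma *)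

Section Goursat.
Context {R : realType}.
Local Notation C := (R[i]^o).
Implicit Types (f g F : C -> C) (a b c t M : R) (z p w : C).

Lemma cderiv_cst (k z : C) : cderiv (fun=> k) z 0.
Proof. by apply/is_deriveP; exact: is_derive_cst. Qed.

Lemma cderiv_id (z : C) : cderiv id z 1.
Proof. by apply/is_deriveP; exact: is_derive_id. Qed.

Lemma cderivD f g z (u v : C) : cderiv f z u -> cderiv g z v ->
  cderiv (fun z => f z + g z) z (u + v).
Proof. by move=> /is_deriveP fu /is_deriveP gv; apply/is_deriveP; exact: is_deriveD. Qed.

Lemma cderivB f g z (u v : C) : cderiv f z u -> cderiv g z v ->
  cderiv (fun z => f z - g z) z (u - v).
Proof. by move=> /is_deriveP fu /is_deriveP gv; apply/is_deriveP; exact: is_deriveB. Qed.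

Lemma cderivM f g z (u v : C) : cderiv f z u -> cderiv g z v ->
  cderiv (fun z => f z * g z) z (f z * v + g z * u).
Proof. by move=> /is_deriveP fu /is_deriveP gv; apply/is_deriveP; exact: is_deriveM. Qed.

Lemma cderivV f z (u : C) : f z != 0 -> cderiv f z u ->
  cderiv (fun z => (f z)^-1) z (- (f z) ^- 2 * u).
Proof.
move=> fz /is_deriveP [df vf]; apply/is_deriveP; split; first exact: derivableV.
by rewrite deriveV// vf.
Qed.

Lemma cderiv_eq f z (u v : C) : u = v -> cderiv f z u -> cderiv f z v.
Proof. by move=> ->. Qed.

Lemma cderivX f n z (u : C) : cderiv f z u ->
  cderiv (fun z => f z ^+ n) z (n%:R * f z ^+ n.-1 * u).
Proof.
move=> fu; elim: n => [|n IH].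
  by rewrite mul0r mul0r; exact: cderiv_cst.
have -> : (fun z => f z ^+ n.+1) = (fun z => f z * f z ^+ n).
  by apply/funext => x; rewrite exprS.
apply: cderiv_eq (cderivM fu IH); rewrite /= -natr1.
by case: n {IH} => [|n]; rewrite ?expr0 ?exprS /=; ring.
Qed.

Lemma near_cderiv f g z (u : C) r : 0 < r ->
  (forall w, cabs (w - z) < r -> f w = g w) -> cderiv f z u -> cderiv g z u.
Proof.
move=> r0 fg H e /H [t t0 K]; exists (Num.min t r); first by rewrite lt_min t0.
move=> h; rewrite lt_min => /andP[ht hr]; rewrite -!fg ?K//.
  by rewrite subrr cabs0.
by rewrite addrC addKr.
Qed.

Lemma ccontB f g z : ccont f z -> ccont g z -> ccont (fun z => f z - g z) z.
Proof.
move=> /ccontP cf /ccontP cg; apply/ccontP.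
exact: (@cvgB _ C _ (nbhs z) _ f g (f z) (g z) cf cg).
Qed.

Lemma ccontD f g z : ccont f z -> ccont g z -> ccont (fun z => f z + g z) z.
Proof.
move=> /ccontP cf /ccontP cg; apply/ccontP.
exact: (@cvgD _ C _ (nbhs z) _ f g (f z) (g z) cf cg).
Qed.

Lemma ccontM f g z : ccont f z -> ccont g z -> ccont (fun z => f z * g z) z.
Proof.
move=> /ccontP cf /ccontP cg; apply/ccontP.
exact: (@cvgM _ _ (nbhs z) _ f g (f z) (g z) cf cg).
Qed.

Lemma ccont_cst (k z : C) : ccont (fun=> k) z.
Proof. by apply/ccontP; exact: cvg_cst. Qed.

(** If the integral had modulus [m > 0], bisection would give arbitrarily small rectangles around a
    point [p] on which the modulus is at least [k] times the area. But near [p] the function [f] is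
    an affine function, which has a primitive, plus an error [er] that is small compared with the
    size of the rectangle. *)
Lemma goursat f a c (u v : R) : 0 < u -> 0 < v ->
  (forall z, inrect a (a + u) c (c + v) z -> exists d, cderiv f z d) ->
  rect f a (a + u) c (c + v) = 0.
Proof.
move=> u0 v0 df; apply/eqP; rewrite -cabs_eq0; apply: contraT => mu0.
set m := cabs _ in mu0; have {}mu0 : 0 < m by rewrite lt_def mu0 cabs_ge0.
pose k := m / (u * v).
have cf z : inrect a (a + u) c (c + v) z -> ccont f z.
  by move=> /df [d]; exact: cderiv_cont.
pose P a' c' u' v' := [/\ a <= a', a' + u' <= a + u, c <= c' & c' + v' <= c + v] /\
   k * (u' * v') <= cabs (rect f a' (a' + u') c' (c' + v')).
have uv0 : 0 < u * v by rewrite mulr_gt0.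
have [||x [y [xy H]]] := @bisection R P a c u v u0 v0.
- move=> a' c' u' v' u'0 v'0 [[A1 A2 A3 A4] Hk]; apply: contrapT => noP.
  (* Four quarters all below the threshold would contradict the additivity of the integral. *)
  have {}noP (s t : bool) :
      cabs (rect f (a' + s%:R * u') (a' + s%:R * u' + u')
        (c' + t%:R * v') (c' + t%:R * v' + v'))
      < k * (u' * v').
    rewrite ltNge; apply/negP => N; apply: noP; exists s, t; split => //.
    clear -A1 A2 A3 A4 u'0 v'0; case: s t => [] [] /=;
      by rewrite ?mulr1n ?mulr0n ?mul1r ?mul0r ?addr0; split; lra.
  have := noP true true; have := noP true false; have := noP false true.
  have := noP false false => {noP}.
  rewrite /= !mulr1n !mulr0n !mul1r !mul0r !addr0.
  have -> : a' + u' + u' = a' + 2 * u' by ring.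
  have -> : c' + v' + v' = c' + 2 * v' by ring.
  have E : rect f a' (a' + 2 * u') c' (c' + 2 * v') =
      rect f a' (a' + u') c' (c' + v') + rect f a' (a' + u') (c' + v') (c' + 2 * v') +
      (rect f (a' + u') (a' + 2 * u') c' (c' + v') +
       rect f (a' + u') (a' + 2 * u') (c' + v') (c' + 2 * v')).
    rewrite (@rect_splitx R (a' + u')); first congr (_ + _).
    + apply: rect_splity; [lra|lra|move=> z /andP[/andP[? ?] /andP[? ?]]].
      by apply: cf; rewrite /inrect; lra.
    + apply: rect_splity; [lra|lra|move=> z /andP[/andP[? ?] /andP[? ?]]].
      by apply: cf; rewrite /inrect; lra.
    + by lra.
    + by lra.
    + by move=> z /andP[/andP[? ?] /andP[? ?]]; apply: cf; rewrite /inrect; lra.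
  move: Hk; rewrite E; do !move: (rect _ _ _ _ _) => ?.
  move=> /le_trans/(_ (le_trans (cabsD _ _) (lerD (cabsD _ _) (cabsD _ _)))).
  have -> : k * (2 * u' * (2 * v')) = 4 * (k * (u' * v')) by ring.
  move: (k * _) => ?; do !move: (cabs _) => ?; lra.
- split; first by split.
  by rewrite /k divfK ?gt_eqF.
have [d Hd] := df _ xy.
pose p := x +i* y : C.
(* With this [e], [rect_bound] yields at most [4 * e * (l * (u + v)) ^+ 2 = m * l ^+ 2 / 2], half of
   the lower bound [m * l ^+ 2]. *)
pose e := m / (8 * (u + v) ^+ 2).
have uv2 : 0 < (u + v) ^+ 2 by rewrite exprn_gt0// addr_gt0.
have e0 : 0 < e by rewrite divr_gt0// mulr_gt0.
have [r r0 Hr] := Hd e e0.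
have [a' [c' [l [[/andP[l0 l1] lr] [[A1 A2 A3 A4] Hk] xy' _]]]] := H r r0.
have lu : 0 < l * u by rewrite mulr_gt0.
have lv : 0 < l * v by rewrite mulr_gt0.
have au : a' <= a' + l * u by lra.
have cv : c' <= c' + l * v by lra.
pose aff (z : C) := f p + d * (z - p).
pose er (z : C) := f z - aff z.
have caff z : ccont aff z.
  apply: ccontD; first exact: ccont_cst.
  apply: ccontM; first exact: ccont_cst.
  by apply: ccontB; [exact: cderiv_cont (cderiv_id _)|exact: ccont_cst].
have cf' z : inrect a' (a' + l * u) c' (c' + l * v) z -> ccont f z.
  move=> /andP[/andP[? ?] /andP[? ?]]; apply: cf; rewrite /inrect; lra.
have cer z : inrect a' (a' + l * u) c' (c' + l * v) z -> ccont er z.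
  by move=> /cf' ?; exact: ccontB.
have E : rect f a' (a' + l * u) c' (c' + l * v) = rect er a' (a' + l * u) c' (c' + l * v).
  rewrite -[RHS]addr0 -(@rect_prim R a' _ c' _ au cv 
    (fun z => f p * z + d / 2 * (z - p) ^+ 2) aff); first last.
  + move=> z _; apply: cderiv_eq (cderivD
      (cderivM (cderiv_cst (f p) z) (cderiv_id z))
      (cderivM (cderiv_cst (d / 2) z) (cderivX 2 (cderivB (cderiv_id z) (cderiv_cst p z))))).
    by rewrite /aff/=; field.
  + by [].
  rewrite -rectD//; last by move=> z [/cer].
  by apply: eq_rect => // z _; rewrite /er subrK.
have er_le z : inrect a' (a' + l * u) c' (c' + l * v) z -> cabs (er z) <= e * (l * (u + v)).
  move=> zin; have zp : cabs (z - p) <= l * (u + v).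
    rewrite (le_trans (cabs_le _))// cReB cImB /=.
    move: zin xy' => /andP[/andP[? ?] /andP[? ?]] /andP[/=/andP[? ?] /andP[? ?]].
    have -> : l * (u + v) = l * u + l * v by ring.
    by apply: lerD; rewrite ler_norml; lra.
  have := Hr (z - p) (le_lt_trans zp lr).
  have -> : er z = f (p + (z - p)) - f p - d * (z - p).
    by rewrite /er /aff opprD addrA [p + _]addrC subrK.
  move=> /le_trans; apply.
  by rewrite (ler_wpM2l (ltW e0)).
have := @rect_bound R a' _ c' _ au cv er _ _ (fun z Hz => er_le z Hz.1).
move=> /(_ (fun z Hz => cer z Hz.1)); rewrite -E.
move=> /(le_trans Hk).
have -> : 4 * (e * (l * (u + v))) * (a' + l * u - a' + (c' + l * v - c')) = m * l ^+ 2 / 2.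
  by rewrite /e; field; rewrite gt_eqF// addr_gt0.
have -> : k * (l * u * (l * v)) = m * l ^+ 2.
  by rewrite /k; field; rewrite !gt_eqF.
have : 0 < m * l ^+ 2 by rewrite mulr_gt0// exprn_gt0.
lra.
Qed.

End Goursat.

(** * Taylor expansion by Cauchy's method on a square *)

Section Cauchy.
Context {R : realType}.
Local Notation C := (R[i]^o).
Implicit Types (f g F : C -> C) (a b c t M : R) (z p w : C).

Lemma goursat_rect f a b c (d : R) : a < b -> c < d ->
  (forall z, inrect a b c d z -> exists l, cderiv f z l) -> rect f a b c d = 0.
Proof.
move=> ab cd; have := @goursat R f a c (b - a) (d - c).
by rewrite !subr_gt0 ![_ + (_ - _)]addrC !subrK; apply.
Qed.

(** Two vertical and two horizontal cuts isolate a square of half-width [e] around [w]. The other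
    pieces contribute zero, and the square at most [16 * M * e], where [M] bounds [f] near [w] by
    continuity. *)
Lemma goursat_except f a b c (d : R) w :
  a < complex.Re w < b -> c < complex.Im w < d ->
  (forall z, inrect a b c d z -> ccont f z) ->
  (forall z, inrect a b c d z -> z != w -> exists l, cderiv f z l) ->
  rect f a b c d = 0.
Proof.
case: w => x y /= /andP[ax xb] /andP[cy yd] cf df; set w := x +i* y in df.
apply/eqP; rewrite -cabs_eq0; apply: contraT => m0; set m := cabs _ in m0.
have {}m0 : 0 < m by rewrite lt_def m0 cabs_ge0.
have win : inrect a b c d w by rewrite /inrect /= !ltW.
have [r r0 Hr] := cf w win 1 ltr01.
pose M := cabs (f w) + 1; have M0 : 0 < M by rewrite ltr_wpDl// cabs_ge0.
have [e [e0 er ea eb [ec ed em]]] : exists e : R,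
    [/\ 0 < e, 2 * e < r, a < x - e, x + e < b & [/\ c < y - e, y + e < d & 16 * M * e < m]].
  pose e0 := Num.min (Num.min (x - a) (b - x)) (Num.min (y - c) (d - y)).
  pose e1 := Num.min e0 (Num.min (r / 2) (m / (16 * M))).
  have e1_gt0 : 0 < e1.
    by rewrite /e1 /e0 !lt_min !subr_gt0 ax xb cy yd !divr_gt0// mulr_gt0.
  exists (e1 / 2); have : e1 / 2 < e1 by lra.
  rewrite {2}/e1 /e0 !lt_min !ltr_pdivlMr ?mulr_gt0// => H.
  have {H}/andP[/andP[/andP[h1 h2] /andP[h3 h4]] /andP[h5 h6]] := H.
  by split; [lra|lra|lra|lra|split; lra].
have xx : x - e <= x + e by lra.
have yy : y - e <= y + e by lra.
(* The pieces that avoid [w] fall under Goursat's lemma. *)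
have nw (A B A' B' : R) : (A <= x <= B) && (A' <= y <= B') = false ->
    a <= A -> B <= b -> c <= A' -> B' <= d ->
    A < B -> A' < B' -> rect f A B A' B' = 0.
  move=> out aA Bb cA Bd AB AB'; apply: goursat_rect => // z zin; apply: df.
    move: zin => /andP[/andP[? ?] /andP[? ?]]; rewrite /inrect; lra.
  by apply: contraFneq out => zw; move: zin; rewrite zw.
have E : rect f a b c d = rect f (x - e) (x + e) (y - e) (y + e).
  rewrite (@rect_splitx R (x - e))//; first last.
  - by lra.
  - by lra.
  rewrite (@rect_splitx R (x + e) (x - e)); first last.
  - by move=> z /andP[/andP[? ?] /andP[? ?]]; apply: cf; rewrite /inrect; lra.
  - by lra.
  - by lra.
  rewrite (@rect_splity R (y - e) (x - e)); first last.
  - by move=> z /andP[/andP[? ?] /andP[? ?]]; apply: cf; rewrite /inrect; lra.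
  - by lra.
  - by lra.
  rewrite (@rect_splity R (y + e) (x - e) _ (y - e)); first last.
  - by move=> z /andP[/andP[? ?] /andP[? ?]]; apply: cf; rewrite /inrect; lra.
  - by lra.
  - by lra.
  rewrite (nw a (x - e)); [|lra..].
  rewrite (nw (x + e) b); [|lra..].
  rewrite (nw _ _ c (y - e)); [|lra..].
  rewrite (nw _ _ (y + e) d); [|lra..].
  by rewrite !add0r !addr0.
have inn z : inrect (x - e) (x + e) (y - e) (y + e) z -> cabs (f z) <= M.
  move=> /andP[/andP[? ?] /andP[? ?]].
  have zw : cabs (z - w) < r.
    rewrite (le_lt_trans (cabs_le _))// cReB cImB /=.
    apply: le_lt_trans er; rewrite mulr2n mulrDl mul1r.
    by apply: lerD; rewrite ler_norml; lra.
  have := ltW (Hr z zw); rewrite /M.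
  by have := cabsBl (f z) (f w); lra.
have := @rect_bound R _ _ _ _ xx yy f M _ (fun z Hz => inn z Hz.1).
rewrite -E -/m => H.
have : m <= 4 * M * (x + e - (x - e) + (y + e - (y - e))).
  apply: H => z [/andP[/andP[? ?] /andP[? ?]] _]; apply: cf; rewrite /inrect; lra.
have -> : 4 * M * (x + e - (x - e) + (y + e - (y - e))) = 16 * M * e by ring.
by lra.
Qed.

(** Unboundedness passes to one of the four quarters, hence to arbitrarily small rectangles around
    some point, against continuity there. *)
Lemma rect_bounded f a b c (d : R) : a < b -> c < d ->
  (forall z, inrect a b c d z -> ccont f z) ->
  exists M, forall z, inrect a b c d z -> cabs (f z) <= M.
Proof.
move=> ab cd cf; apply: contrapT => ub.
pose P a' c' u' v' := [/\ a <= a', a' + u' <= b, c <= c' & c' + v' <= d] /\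
  ~ exists M, forall z, inrect a' (a' + u') c' (c' + v') z -> cabs (f z) <= M.
have [u0 v0] : 0 < b - a /\ 0 < d - c by rewrite !subr_gt0.
have [||x [y [xy H]]] := @bisection R P a c _ _ u0 v0.
- move=> a' c' u v u1 v1 [[A1 A2 A3 A4] N]; apply: contrapT => nP; apply: N.
  have bnd (s t : bool) : exists M, forall z,
      inrect (a' + s%:R * u) (a' + s%:R * u + u) (c' + t%:R * v) (c' + t%:R * v + v) z ->
      cabs (f z) <= M.
    apply: contrapT => N; apply: nP; exists s, t; split => //.
    clear -A1 A2 A3 A4 u1 v1; case: s t => [] [] /=;
      by rewrite ?mulr1n ?mulr0n ?mul1r ?mul0r ?addr0; split; lra.
  have := bnd true true; have := bnd true false; have := bnd false true.
  have := bnd false false; rewrite /= !mulr1n !mulr0n !mul1r !mul0r !addr0.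
  move=> [M1 H1] [M2 H2] [M3 H3] [M4 H4].
  exists (Num.max (Num.max M1 M2) (Num.max M3 M4)) => z /andP[/andP[z1 z2] /andP[z3 z4]].
  rewrite !le_max.
  have [zx|/ltW zx] := leP (complex.Re z) (a' + u);
  have [zy|/ltW zy] := leP (complex.Im z) (c' + v).
  + by rewrite H1// /inrect; apply/andP; split; apply/andP; split; lra.
  + by rewrite H2 ?orbT// /inrect; apply/andP; split; apply/andP; split; lra.
  + by rewrite H3 ?orbT// /inrect; apply/andP; split; apply/andP; split; lra.
  + by rewrite H4 ?orbT// /inrect; apply/andP; split; apply/andP; split; lra.
- by rewrite /P ![_ + (_ - _)]addrC !subrK.
have [||r r0 Hr] := cf (x +i* y) _ 1 => //.
  by move: xy; rewrite ![_ + (_ - _)]addrC !subrK.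
have [a' [c' [l [[/andP[l0 l1] lr] [_ N] /andP[/andP[? ?] /andP[? ?]] _]]]] := H r r0.
apply: N; exists (cabs (f (x +i* y)) + 1) => z /andP[/andP[? ?] /andP[? ?]].
have zw : cabs (z - (x +i* y)) < r.
  rewrite (le_lt_trans (cabs_le _))// cReB cImB /=.
  apply: le_lt_trans lr; rewrite mulrDr.
  by apply: lerD; rewrite ler_norml; simpl in *; lra.
by have := ltW (Hr z zw); have := cabsBl (f z) (f (x +i* y)); lra.
Qed.

(** * Cauchy's integral formula on the square of half-width [r] centred at the origin *)

Section square.
Variable r : R.
Hypothesis r0 : 0 < r.
Local Notation sq f := (rect f (- r) r (- r) r).
Local Notation insq z := (inrect (- r) r (- r) r z).
Local Notation bdsq z := (bdrect (- r) r (- r) r z).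

Let rr : - r <= r. Proof. by move: r0 => ?; lra. Qed.

Lemma bdsq_ge z : bdsq z -> r <= cabs z.
Proof.
move=> [_ [E|E|E|E]].
- by rewrite (le_trans _ (cabs_Re z))// E normrN ger0_norm// ltW.
- by rewrite (le_trans _ (cabs_Re z))// E ger0_norm// ltW.
- by rewrite (le_trans _ (cabs_Im z))// E normrN ger0_norm// ltW.
- by rewrite (le_trans _ (cabs_Im z))// E ger0_norm// ltW.
Qed.

Lemma bdsq_neq0 z : bdsq z -> z != 0.
Proof. by move=> /bdsq_ge rz; rewrite -cabs_gt0 (lt_le_trans r0). Qed.

Lemma bdsq_invX n z : bdsq z -> cabs (z^-1 ^+ n) <= r^-1 ^+ n.
Proof.
move=> zb; rewrite cabsX cabsV lerXn2r ?nnegrE ?invr_ge0 ?cabs_ge0 ?(ltW r0)//.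
by rewrite lef_pV2 ?posrE ?cabs_gt0 ?bdsq_neq0 ?bdsq_ge.
Qed.

Lemma cderiv_invX n z : z != 0 ->
  cderiv (fun z => z^-1 ^+ n) z (- n%:R * z^-1 ^+ n.+1).
Proof.
move=> z0; apply: cderiv_eq (cderivX n (cderivV (f := id) z0 (cderiv_id z))).
case: n => [|n]; first by rewrite oppr0 !mul0r.
by rewrite /= mulr1 -exprVn mulrN mulNr -mulrA -exprD addn2.
Qed.

Lemma ccont_invX n z : z != 0 -> ccont (fun z => z^-1 ^+ n) z.
Proof. by move=> z0; exact: cderiv_cont (cderiv_invX n z0). Qed.

(* [kappa = 2 i pi], but only [kappa != 0] and [|kappa| >= 1] matter. *)
Definition kappa : C := sq (fun z => z^-1).

(** The offset leaves out the exponent 1, whose integral is [kappa]; the higher negative powers have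
    a primitive. *)
Lemma sq_invX n : sq (fun z => z^-1 ^+ n.+2) = 0.
Proof.
rewrite (rect_prim rr rr (F := fun z => - n.+1%:R^-1 * z^-1 ^+ n.+1))//.
  by move=> z /bdsq_neq0; exact: ccont_invX.
move=> z /bdsq_neq0 z0.
apply: cderiv_eq (cderivM (cderiv_cst _ z) (cderiv_invX n.+1 z0)).
by rewrite mulr0 addr0 mulrA mulrNN mulVf ?mul1r// pnatr_eq0.
Qed.

(** Each side contributes at least 1 to the imaginary part, because [r / (t ^+ 2 + r ^+ 2)] is at
    least [(2 * r)^-1] on an interval of length [2 * r]. *)
Lemma kappa_ge1 : 1 <= cabs kappa.
Proof.
rewrite (le_trans _ (cabs_Im _))// (le_trans _ (ler_norm _))//.
have cV z : bdsq z -> ccont (fun z : C => z^-1) z.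
  by move=> /bdsq_neq0 z0; apply: cderiv_cont (cderivV (f := id) z0 (cderiv_id z)).
have [c1 c2 c3 c4] := rect_sides rr rr cV.
have i1 := cconti_Im (line_cconti cabs1 c1).
have i2 := cconti_Re (line_cconti (@cabsi R) c2).
have i3 := cconti_Im (line_cconti cabs1 c3).
have i4 := cconti_Re (line_cconti (@cabsi R) c4).
have q t : - r <= t <= r -> 0 < t ^+ 2 + r ^+ 2 <= 2 * r ^+ 2.
  move=> tr; have : 0 < r ^+ 2 by rewrite exprn_gt0.
  have : 0 <= t ^+ 2 by rewrite sqr_ge0.
  have : 0 <= (r - t) * (r + t) by rewrite mulr_ge0//; lra.
  move=> ? ? ?; apply/andP; split; lra.
have q1 t : - r <= t <= r -> (2 * r)^-1 <= r / (t ^+ 2 + r ^+ 2).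
  move=> /q /andP[q0 q1]; rewrite ler_pdivlMr// mulrC ler_pdivrMr ?mulr_gt0//.
  by move: q1; rewrite expr2; lra.
have rE : 1 = (2 * r)^-1 * (r - - r) by field; rewrite gt_eqF.
have lo u : rcont (- r) r u ->
    (forall t, - r <= t <= r -> u t = r / (t ^+ 2 + r ^+ 2)) ->
    1 <= rint (- r) r u.
  by move=> cu uE; rewrite rE; apply: rint_ge => // t tr; rewrite uE// q1.
have hi u : rcont (- r) r u ->
    (forall t, - r <= t <= r -> u t = - (r / (t ^+ 2 + r ^+ 2))) ->
    rint (- r) r u <= - 1.
  move=> cu uE; rewrite rE -mulNr -(rint_cst _ rr); apply: rint_le => //.
    exact: cst_rcont.
  by move=> t tr; rewrite uE// lerN2 q1.
have VE (x y : R) : (x +i* y : C)^-1 = (x / (x ^+ 2 + y ^+ 2)) -i* (y / (x ^+ 2 + y ^+ 2)).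
  by [].
have {i1 lo}[k1 k2] :
    1 <= rint (- r) r (@complex.Im R \o (fun t => (0 +i* - r + t%:C * 1)^-1)) /\
    1 <= rint (- r) r (@complex.Re R \o (fun t => (r +i* 0 + t%:C * 'i)^-1)).
  split; apply: lo => // t _; rewrite [LHS]/comp ?hpoint ?vpoint VE [LHS]/=.
    by rewrite sqrrN mulNr opprK.
  by rewrite [r ^+ 2 + _]addrC.
have {i3 i4 hi}[k3 k4] :
    rint (- r) r (@complex.Im R \o (fun t => (0 +i* r + t%:C * 1)^-1)) <= -1 /\
    rint (- r) r (@complex.Re R \o (fun t => (- r +i* 0 + t%:C * 'i)^-1)) <= -1.
  split; apply: hi => // t _; rewrite [LHS]/comp ?hpoint ?vpoint VE [LHS]/= //.
  by rewrite sqrrN mulNr [r ^+ 2 + _]addrC.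
rewrite /kappa /rect !cImB cImD /line !mul1r !cImM /= !mul0r !add0r !mul1r.
by move: k1 k2 k3 k4; do !move: (rint _ _ _) => ?; lra.
Qed.

Definition psum (a : nat -> C) w (l : C) := forall e, 0 < e ->
  exists N, forall n, (N <= n)%N -> cabs (\sum_(i < n) a i * w ^+ i - l) < e.

Lemma cvg_geo (q K e : R) : 0 <= q < 1 -> 0 < e ->
  exists N, forall n, (N <= n)%N -> K * q ^+ n < e.
Proof.
move=> /andP[q0 q1] e0.
have cv : (fun n => K * q ^+ n) @ \oo --> K * 0.
  by apply: cvgMr; apply: cvg_expr; rewrite ger0_norm.
rewrite mulr0 in cv.
move/cvgrPdist_lt: cv => /(_ _ e0) [N _ HN]; exists N => n /HN /=.
by rewrite sub0r normrN; apply: le_lt_trans; exact: ler_norm.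
Qed.

(** Cauchy's formula for the [n]-th Taylor coefficient at 0, with [kappa] in place of [2 i pi]. *)
Definition ccoef f n : C := sq (fun z => f z * z^-1 ^+ n.+1) / kappa.

(** Boundary points have modulus at least [r], so [rect_bound] gives
    [4 * (M / r ^+ n.+1) * (4 * r)]; dividing by [kappa] does not increase the modulus. *)
Lemma ccoef_bound f M n : (forall z, bdsq z -> ccont f z) ->
  (forall z, bdsq z -> cabs (f z) <= M) -> cabs (ccoef f n) <= 16 * M / r ^+ n.
Proof.
move=> cf fM.
have M0 : 0 <= M.
  apply: le_trans (fM (r +i* 0) _); first exact: cabs_ge0.
  split; [|exact: Or42]; by rewrite /inrect/= lexx rr oppr_le0 ltW.
rewrite cabsM cabsV ler_pdivrMr; last exact: lt_le_trans ltr01 kappa_ge1.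
apply: (@le_trans _ _ (16 * M / r ^+ n)); last first.
  by rewrite ler_peMr ?kappa_ge1// divr_ge0 ?mulr_ge0// exprn_ge0// ltW.
have -> : 16 * M / r ^+ n = 4 * (M * r^-1 ^+ n.+1) * (r - - r + (r - - r)).
  by rewrite exprVn exprS; field; rewrite expf_neq0 gt_eqF.
apply: rect_bound => //.
  by move=> z zb; apply: ccontM; [exact: cf|apply: ccont_invX; exact: bdsq_neq0].
move=> z zb; by rewrite cabsM ler_pM ?cabs_ge0 ?fM// bdsq_invX.
Qed.

(* Goursat's lemma applies to [k z = (f z - f w) / (z - w)].  The integrals [RN n]
   of [k z * z ^- n] satisfy [RN 0 = 0] and
   [RN n = b n - f w * (integral of z ^- n.+1) + w * RN n.+1], so that [RN N], up
   to the factor [- w ^+ N / kappa], is the [N]-th remainder of the series. *)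
Lemma cauchy_series f w : (forall z, insq z -> exists d, cderiv f z d) ->
  cabs w < r -> psum (ccoef f) w (f w).
Proof.
move=> df wr.
have cf z : insq z -> ccont f z by move=> /df [d]; exact: cderiv_cont.
have wRe : - r < complex.Re w < r by rewrite -ltr_norml (le_lt_trans (cabs_Re _)).
have wIm : - r < complex.Im w < r by rewrite -ltr_norml (le_lt_trans (cabs_Im _)).
have win : insq w by move: wRe wIm => /andP[? ?] /andP[? ?]; rewrite /inrect !ltW.
have [d dw] := df w win.
(* The value [d] at [w] makes [k] continuous there, which is what [goursat_except] asks at its
   exceptional point. *)
pose k z : C := if z == w then d else (f z - f w) / (z - w).
have dk z : insq z -> z != w -> exists l, cderiv k z l.
  move=> /df [l dl] zw.
  have zw0 : z - w != 0 by rewrite subr_eq0.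
  have D := cderivM (cderivB dl (cderiv_cst (f w) z))
    (cderivV (f := fun z => z - w) zw0 (cderivB (cderiv_id z) (cderiv_cst w z))).
  eexists; apply: (near_cderiv (r := cabs (z - w))) D; first by rewrite cabs_gt0.
  move=> x xz; rewrite /k ifN//; apply: contraTneq xz => ->.
  by rewrite cabsC ltxx.
have kw : ccont k w.
  move=> e e0; have [t t0 Ht] := dw (e / 2) (divr_gt0 e0 (ltr0Sn _ _)).
  exists t => // z zt.
  have [->|zw] := eqVneq z w; first by rewrite subrr cabs0.
  have := Ht _ zt; rewrite [w + _]addrC subrK /k eqxx (negbTE zw).
  have zw0 : z - w != 0 by rewrite subr_eq0.
  have -> : (f z - f w) / (z - w) - d = (f z - f w - d * (z - w)) / (z - w) by field.
  have zn : 0 < cabs (z - w) by rewrite cabs_gt0.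
  rewrite cabsM cabsV ltr_pdivrMr// => /le_lt_trans; apply.
  by rewrite ltr_pM2r//; lra.
have ck z : insq z -> ccont k z.
  have [->//|zw zin] := eqVneq z w.
  by have [l /cderiv_cont] := dk z zin zw.
have k0 : sq k = 0.
  by apply: (@goursat_except k _ _ _ _ w).
have ckb z : bdsq z -> ccont k z by case=> /ck.
have cfb z : bdsq z -> ccont f z by case=> /cf.
pose RN n := sq (fun z => k z * z^-1 ^+ n).
pose b n := sq (fun z => f z * z^-1 ^+ n.+1).
have rec n : RN n = b n - f w * sq (fun z => z^-1 ^+ n.+1) + w * RN n.+1.
  have cI m z : bdsq z -> ccont (fun z : C => z^-1 ^+ m) z.
    by move=> zb; apply: ccont_invX; exact: bdsq_neq0.
  have cfI z : bdsq z -> ccont (fun z => f z * z^-1 ^+ n.+1) z.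
    by move=> zb; apply: ccontM; [exact: cfb|exact: cI].
  have ckI z : bdsq z -> ccont (fun z => k z * z^-1 ^+ n.+1) z.
    by move=> zb; apply: ccontM; [exact: ckb|exact: cI].
  have cZ (l : C) g z : ccont g z -> ccont (fun z => l * g z) z.
    by move=> cg; apply: ccontM => //; exact: ccont_cst.
  rewrite -mulNr /b /RN.
  rewrite -(@rectZ R _ _ _ _ rr rr (- f w) (fun z => z^-1 ^+ n.+1)); last exact: cI.
  rewrite -rectD//; last by move=> z zb; apply: cZ; exact: cI.
  rewrite -(@rectZ R _ _ _ _ rr rr w (fun z => k z * z^-1 ^+ n.+1))//.
  rewrite -rectD//; last by move=> z zb; apply: cZ; exact: ckI.
    apply: eq_rect => // z zb.
    have zw : z != w by apply: contraTneq (bdsq_ge zb) => ->; rewrite -ltNge.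
    rewrite /k (negbTE zw) exprS.
    by field; rewrite subr_eq0 zw (bdsq_neq0 zb).
  by move=> z zb; apply: ccontD; [exact: cfI|apply: cZ; exact: cI].
have k_neq0 : kappa != 0 by rewrite -cabs_gt0 (lt_le_trans ltr01 kappa_ge1).
have RNE n : \sum_(i < n.+1) ccoef f i * w ^+ i - f w = - (w ^+ n.+1 * RN n.+1 / kappa).
  have {}rec m : w * RN m.+1 = RN m - b m + f w * sq (fun z => z^-1 ^+ m.+1).
    by rewrite (rec m); ring.
  elim: n => [|n IH].
    rewrite big_ord_recl big_ord0 addr0 /= expr0 mulr1 expr1 rec /ccoef -/(b 0).
    have -> : RN 0 = 0 by rewrite -[RHS]k0; apply: eq_rect => // z _; rewrite expr0 mulr1.
    have -> : sq (fun z : C => z^-1 ^+ 1) = kappa by apply: eq_rect => // z _; rewrite expr1.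
    by field.
  rewrite big_ord_recr /= addrAC IH [w ^+ n.+2]exprSr -[_ * w * _]mulrA rec.
  by rewrite sq_invX mulr0 addr0 /ccoef -/(b n.+1); field.
have Nrr : - r < r by move: r0 => ?; lra.
have [K HK] := rect_bounded Nrr Nrr ck.
move=> e e0.
have q01 : 0 <= cabs w / r < 1.
  by rewrite divr_ge0 ?cabs_ge0 ?(ltW r0)//= ltr_pdivrMr// mul1r.
have [N HN] := cvg_geo (4 * K * (r - - r + (r - - r))) q01 e0.
exists N.+1 => -[//|n] /ltnW /HN; apply: le_lt_trans.
rewrite RNE cabsN !cabsM cabsV cabsX ler_pdivrMr; last exact: lt_le_trans ltr01 kappa_ge1.
set L := r - - r + (r - - r); have L0 : 0 <= L by rewrite /L; move: r0 => ?; lra.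
have K0 : 0 <= K by apply: le_trans (HK w win); exact: cabs_ge0.
have RB : cabs (RN n.+1) <= 4 * (K * r^-1 ^+ n.+1) * L.
  apply: rect_bound => //.
    by move=> z zb; apply: ccontM; [exact: ckb|apply: ccont_invX; exact: bdsq_neq0].
  move=> z zb; rewrite cabsM ler_pM ?cabs_ge0 ?HK//; first by case: zb.
  exact: bdsq_invX.
have wn : 0 <= cabs w ^+ n.+1 by rewrite exprn_ge0// cabs_ge0.
apply: (le_trans (ler_wpM2l wn RB)).
have -> : cabs w ^+ n.+1 * (4 * (K * r^-1 ^+ n.+1) * L) = 4 * K * L * (cabs w / r) ^+ n.+1.
  by rewrite exprMn; ring.
rewrite ler_peMr ?kappa_ge1// mulr_ge0//; first by rewrite !mulr_ge0.
by rewrite exprn_ge0// divr_ge0 ?cabs_ge0// ltW.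
Qed.

End square.
End Cauchy.

(** * Power series *)

Section PowerSeries.
Context {R : realType}.
Local Notation C := (R[i]^o).
Implicit Types (f g F S : C -> C) (a b : nat -> C) (z p w h c : C) (M r s t : R).

Lemma psum_unique a w (l m : C) : psum a w l -> psum a w m -> l = m.
Proof.
move=> Hl Hm; apply/eqP; rewrite -subr_eq0 -cabs_eq0; apply: contraT => n0.
have {}n0 : 0 < cabs (l - m) by rewrite lt_def n0 cabs_ge0.
have [N HN] := Hl _ (divr_gt0 n0 (ltr0Sn _ 1)).
have [N' HN'] := Hm _ (divr_gt0 n0 (ltr0Sn _ 1)).
have := HN (maxn N N') (leq_maxl _ _); have := HN' (maxn N N') (leq_maxr _ _).
set x := \sum_(_ < _) _ => h1 h2.
have := cabs_tri l x m; rewrite [cabs (l - x)]cabsC; lra.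
Qed.

Lemma psum_eq0 a w (l : C) : (forall n, a n = 0) -> psum a w l -> l = 0.
Proof.
move=> a0 Hl; apply: psum_unique Hl _ => e e0; exists 0%N => n _.
by rewrite subr0 big1 ?cabs0// => i _; rewrite a0 mul0r.
Qed.

Lemma psum_0 a (l : C) : psum a 0 l -> l = a 0%N.
Proof.
move=> Hl; apply: psum_unique Hl _ => e e0; exists 1%N => -[//|n] _.
rewrite big_ord_recl expr0 mulr1 big1 ?addr0 ?subrr ?cabs0// => i _.
by rewrite expr0n mulr0.
Qed.

Definition geobd a r := exists M, forall n, cabs (a n) <= M / r ^+ n.

(** The real and imaginary parts of the series are dominated by a geometric series of ratio
    [cabs w / r]. *)
Lemma psum_ex a r w : geobd a r -> cabs w < r -> exists l, psum a w l.
Proof.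
move=> [M aM] wr; have r0 : 0 < r := le_lt_trans (cabs_ge0 _) wr.
have M0 : 0 <= M by have := le_trans (cabs_ge0 _) (aM 0); rewrite expr0 divr1.
pose q := cabs w / r.
have q01 : 0 <= q < 1.
  by rewrite divr_ge0 ?cabs_ge0 ?(ltW r0)//= ltr_pdivrMr// mul1r.
have bd i : cabs (a i * w ^+ i) <= M * q ^+ i.
  have -> : M * q ^+ i = M / r ^+ i * cabs w ^+ i by rewrite /q exprMn exprVn; ring.
  by rewrite cabsM cabsX ler_wpM2r ?exprn_ge0 ?cabs_ge0.
have cg : cvgn (series (geometric M q)).
  by apply: is_cvg_geometric_series; rewrite ger0_norm; case/andP: q01.
have cv (u : nat -> R) : (forall i, `|u i| <= cabs (a i * w ^+ i)) -> cvgn (series u).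
  move=> ub; apply: normed_cvg; apply: series_le_cvg cg => n //=.
    by rewrite mulr_ge0// exprn_ge0//; case/andP: q01.
  exact: le_trans (ub n) (bd n).
have [x Hx] : exists x : R, series (fun i => complex.Re (a i * w ^+ i)) @ \oo --> x.
  by apply/cvg_ex; apply: cv => i; exact: cabs_Re.
have [y Hy] : exists x : R, series (fun i => complex.Im (a i * w ^+ i)) @ \oo --> x.
  by apply/cvg_ex; apply: cv => i; exact: cabs_Im.
exists (x +i* y) => e e0.
have e2 : 0 < e / 2 by rewrite divr_gt0.
move/cvgrPdist_lt: Hx => /(_ _ e2) [N _ HN].
move/cvgrPdist_lt: Hy => /(_ _ e2) [N' _ HN'].
exists (maxn N N') => n; rewrite geq_max => /andP[/HN /= h1 /HN' /= h2].
rewrite (le_lt_trans (cabs_le _))// cReB cImB /=.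
have -> : complex.Re (\sum_(i < n) a i * w ^+ i) =
    series (fun i => complex.Re (a i * w ^+ i)) n.
  rewrite /series /= big_mkord; elim: n {h1 h2} => [|n IH]; first by rewrite !big_ord0.
  by rewrite !big_ord_recr /= cReD IH.
have -> : complex.Im (\sum_(i < n) a i * w ^+ i) =
    series (fun i => complex.Im (a i * w ^+ i)) n.
  rewrite /series /= big_mkord; elim: n {h1 h2} => [|n IH]; first by rewrite !big_ord0.
  by rewrite !big_ord_recr /= cImD IH.
rewrite [`|_ - x|]distrC [`|_ - y|]distrC; lra.
Qed.

(* All terms of the binomial expansion of degree at least 2 in [h] gain a factor
   [(|h| / t) ^+ 2] with respect to that of [(|w| + t) ^+ n]. *)
Lemma expr_taylor2 w h t n : 0 < t -> cabs h <= t ->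
  cabs ((w + h) ^+ n - w ^+ n - n%:R * w ^+ n.-1 * h) <= (cabs h / t) ^+ 2 * (cabs w + t) ^+ n.
Proof.
move=> t0 ht.
suff H : cabs ((w + h) ^+ n - w ^+ n - n%:R * w ^+ n.-1 * h) <=
   (cabs h / t) ^+ 2 * ((cabs w + t) ^+ n - cabs w ^+ n - n%:R * cabs w ^+ n.-1 * t).
  apply: le_trans H _; rewrite ler_wpM2l ?exprn_ge0 ?divr_ge0 ?cabs_ge0 ?(ltW t0)//.
  have := exprn_ge0 n (cabs_ge0 w).
  have : 0 <= n%:R * cabs w ^+ n.-1 * t by rewrite !mulr_ge0 ?exprn_ge0 ?cabs_ge0 ?(ltW t0).
  lra.
elim: n => [|[|n] IH].
- by rewrite !expr0 subrr !mul0r subrr cabs0 subrr subrr mulr0.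
- rewrite !expr1 !expr0 !mul1r.
  have -> : w + h - w - h = 0 by ring.
  have -> : cabs w + t - cabs w - t = 0 by ring.
  by rewrite cabs0 mulr0.
- have -> : (w + h) ^+ n.+2 - w ^+ n.+2 - n.+2%:R * w ^+ n.+2.-1 * h =
     (w + h) * ((w + h) ^+ n.+1 - w ^+ n.+1 - n.+1%:R * w ^+ n.+1.-1 * h) +
     n.+1%:R * w ^+ n * h ^+ 2.
    by rewrite /= -[n.+2%:R]natr1 !exprS; ring.
  have -> : (cabs h / t) ^+ 2 *
       ((cabs w + t) ^+ n.+2 - cabs w ^+ n.+2 - n.+2%:R * cabs w ^+ n.+2.-1 * t) =
     (cabs w + t) * ((cabs h / t) ^+ 2 *
       ((cabs w + t) ^+ n.+1 - cabs w ^+ n.+1 - n.+1%:R * cabs w ^+ n.+1.-1 * t)) +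
     n.+1%:R * cabs w ^+ n * cabs h ^+ 2.
    by rewrite /= -[n.+2%:R]natr1 !exprS; field; rewrite gt_eqF.
  rewrite (le_trans (cabsD _ _))// lerD//.
    rewrite cabsM ler_pM ?cabs_ge0// (le_trans (cabsD _ _))// lerD2l//.
  by rewrite !cabsM !cabsX cabs_natr.
Qed.

(** The coefficients of the series differentiated term by term. *)
Definition dcoef a n : C := n.+1%:R * a n.+1.

(** The factor [n.+1] is absorbed by the smaller radius, through [n.+1%:R * s ^+ n * (r - s) <= r ^+
    n.+1 - s ^+ n.+1], proved by induction. *)
Lemma geobd_dcoef a r s : 0 < s < r -> geobd a r -> geobd (dcoef a) s.
Proof.
move=> /andP[s0 sr] [M aM].
have r0 : 0 < r := lt_trans s0 sr.
have M0 : 0 <= M by have := le_trans (cabs_ge0 _) (aM 0%N); rewrite expr0 divr1.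
have rs : 0 < r - s by rewrite subr_gt0.
exists (M / (r - s)) => n; rewrite cabsM cabs_natr.
apply: (le_trans (ler_wpM2l (ler0n _ _) (aM n.+1))).
have H : n.+1%:R * s ^+ n * (r - s) <= r ^+ n.+1.
  have : forall m, m.+1%:R * s ^+ m * (r - s) <= r ^+ m.+1 - s ^+ m.+1.
    elim=> [|m IH]; first by rewrite expr0 !expr1 !mul1r.
    have h1 : r * (m.+1%:R * s ^+ m * (r - s)) <= r * (r ^+ m.+1 - s ^+ m.+1).
      by rewrite ler_wpM2l// ltW.
    have h2 : m.+1%:R * s ^+ m.+1 * (r - s) <= r * (m.+1%:R * s ^+ m * (r - s)).
      have -> : m.+1%:R * s ^+ m.+1 * (r - s) = s * (m.+1%:R * s ^+ m * (r - s)).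
        by rewrite exprS; ring.
      by rewrite ler_wpM2r ?(ltW sr)// !mulr_ge0 ?exprn_ge0// ltW.
    rewrite -[m.+2%:R]natr1 ![_ ^+ m.+2]exprS.
    move: h1 h2; move: (m.+1%:R) (s ^+ m.+1) (r ^+ m.+1) (s ^+ m) => A B D E h1 h2; lra.
  by move=> /(_ n) /le_trans; apply; rewrite gerBl exprn_ge0// ltW.
have -> : n.+1%:R * (M / r ^+ n.+1) =
    M / (r - s) / s ^+ n * ((n.+1%:R * s ^+ n * (r - s)) / r ^+ n.+1).
  by field; rewrite !expf_neq0 ?gt_eqF.
rewrite ler_piMr ?divr_ge0 ?exprn_ge0 ?(ltW rs) ?(ltW s0)//.
by rewrite ler_pdivrMr ?exprn_gt0// mul1r.
Qed.

Lemma geo_sum_le (q : R) n : 0 <= q < 1 -> \sum_(i < n) q ^+ i <= (1 - q)^-1.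
Proof.
move=> /andP[q0 q1]; have q2 : 0 < 1 - q by rewrite subr_gt0.
rewrite -[leRHS]mul1r ler_pdivlMr//.
have -> : (\sum_(i < n) q ^+ i) * (1 - q) = 1 - q ^+ n.
  elim: n => [|n IH]; first by rewrite big_ord0 mul0r expr0 subrr.
  by rewrite big_ord_recr /= mulrDl IH exprS; ring.
by rewrite gerBl exprn_ge0.
Qed.

(** With [s = cabs w + t < r], [expr_taylor2] bounds the remainder of the linear approximation by
    [(cabs h / t) ^+ 2] times a geometric series of ratio [s / r]. It is therefore at most
    [K * cabs h ^+ 2]. *)
Lemma psum_cderiv a r S w (l : C) : geobd a r ->
  (forall w, cabs w < r -> psum a w (S w)) -> cabs w < r -> psum (dcoef a) w l ->
  cderiv S w l.
Proof.
move=> [M aM] aS wr al; have r0 : 0 < r := le_lt_trans (cabs_ge0 _) wr.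
have M0 : 0 <= M by have := le_trans (cabs_ge0 _) (aM 0%N); rewrite expr0 divr1.
pose t := (r - cabs w) / 2.
have t0 : 0 < t by rewrite divr_gt0// subr_gt0.
pose s := cabs w + t; have sr : s < r by rewrite /s /t; lra.
have s0 : 0 < s by rewrite ltr_wpDl// cabs_ge0.
pose q := s / r.
have q01 : 0 <= q < 1 by rewrite divr_ge0 ?(ltW s0) ?(ltW r0)//= ltr_pdivrMr// mul1r.
pose K := M / (1 - q) / t ^+ 2.
have K0 : 0 <= K.
  by rewrite !mulr_ge0// ?invr_ge0 ?exprn_ge0 ?(ltW t0)// subr_ge0 ltW//; case/andP: q01.
have main h : cabs h <= t -> cabs (S (w + h) - S w - l * h) <= K * cabs h ^+ 2.
  move=> ht.
  have whr : cabs (w + h) < r by rewrite (le_lt_trans (cabsD _ _))// (le_lt_trans _ sr)// lerD2l.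
  (* The bound is proved for partial sums, up to three errors of [e / 3]. The derived series is cut
     one term earlier, because of the index shift in [dcoef]. *)
  apply/ler_addgt0Pr => e e0.
  have e3 : 0 < e / 3 by rewrite divr_gt0.
  have h1 : 0 < 1 + cabs h by rewrite ltr_wpDr// cabs_ge0.
  have [N1 H1] := aS _ whr _ e3; have [N2 H2] := aS _ wr _ e3.
  have [N3 H3] := al _ (divr_gt0 e3 h1).
  pose N := maxn (maxn N1 N2) N3.
  have /H1 {}H1 : (N1 <= N.+1)%N by rewrite leqW// /N !leq_max leqnn.
  have /H2 {}H2 : (N2 <= N.+1)%N by rewrite leqW// /N !leq_max leqnn orbT.
  have /H3 {}H3 : (N3 <= N)%N by rewrite /N !leq_max leqnn orbT.
  have H3' : cabs ((\sum_(i < N) dcoef a i * w ^+ i - l) * h) < e / 3.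
    rewrite cabsM; move: H3; rewrite ltr_pdivlMr// mulrDr mulr1; apply: le_lt_trans.
    by rewrite lerDr cabs_ge0.
  have E : \sum_(i < N.+1) a i * (w + h) ^+ i - \sum_(i < N.+1) a i * w ^+ i
      - (\sum_(i < N) dcoef a i * w ^+ i) * h =
      \sum_(i < N.+1) a i * ((w + h) ^+ i - w ^+ i - i%:R * w ^+ i.-1 * h).
    have -> : (\sum_(i < N) dcoef a i * w ^+ i) * h =
        \sum_(i < N.+1) a i * (i%:R * w ^+ i.-1 * h).
      rewrite big_ord_recl mul0r mul0r mulr0 add0r mulr_suml; apply: eq_bigr => i _.
      by rewrite /dcoef /= /bump leq0n add1n add0n; ring.
    by rewrite -!sumrB; apply: eq_bigr => i _; ring.
  have EB : cabs (\sum_(i < N.+1) a i * ((w + h) ^+ i - w ^+ i - i%:R * w ^+ i.-1 * h)) <=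
      K * cabs h ^+ 2.
    apply: (le_trans (cabs_sum N.+1
      (fun i => a i * ((w + h) ^+ i - w ^+ i - i%:R * w ^+ i.-1 * h)))).

    apply: (@le_trans _ _ (\sum_(i < N.+1) M * (cabs h / t) ^+ 2 * q ^+ i)).
      apply: ler_sum => i _; rewrite cabsM.
      apply: (le_trans (ler_pM (cabs_ge0 _) (cabs_ge0 _) (aM i) (expr_taylor2 w i t0 ht))).
      rewrite -/s /q [(s / r) ^+ i]exprMn exprVn le_eqVlt; apply/orP; left; apply/eqP; ring.
    rewrite -mulr_sumr.
    have := geo_sum_le N.+1 q01.
    have ht2 := exprn_ge0 2 (divr_ge0 (cabs_ge0 h) (ltW t0)).
    move=> /(ler_wpM2l (mulr_ge0 M0 ht2)) /le_trans; apply.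
    rewrite /K le_eqVlt; apply/orP; left; apply/eqP; rewrite exprMn exprVn; ring.
  rewrite -E in EB.
  set A1 := \sum_(i < _) _ in H1 EB; set A2 := \sum_(i < _) _ in H2 EB.
  set A3 := \sum_(i < _) _ in H3' EB.
  have -> : S (w + h) - S w - l * h =
      - (A1 - S (w + h)) + (A2 - S w) + (A3 - l) * h + (A1 - A2 - A3 * h).
    by ring.
  have T1 := cabsD (- (A1 - S (w + h)) + (A2 - S w) + (A3 - l) * h) (A1 - A2 - A3 * h).
  have T2 := cabsD (- (A1 - S (w + h)) + (A2 - S w)) ((A3 - l) * h).
  have T3 := cabsD (- (A1 - S (w + h))) (A2 - S w); rewrite cabsN in T3.
  move: T1 T2 T3 H1 H2 H3' EB.
  by do !move: (cabs (_ + _)) => ?; do !move: (cabs (_ * _)) => ?; lra.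
move=> e e0; exists (Num.min t (e / (K + 1))).
  by rewrite lt_min t0 divr_gt0// ltr_wpDl.
move=> h; rewrite lt_min => /andP[/ltW /main /le_trans H he]; apply: H.
rewrite expr2 mulrA ler_wpM2r ?cabs_ge0//.
move: he; rewrite ltr_pdivlMr ?ltr_wpDl//; have := cabs_ge0 h; nra.
Qed.

End PowerSeries.

(** * Iterated derivatives of holomorphic functions *)

Section Taylor.
Context {R : realType}.
Local Notation C := (R[i]^o).
Implicit Types (f g F S : C -> C) (a b : nat -> C) (z p w h c : C) (M r s t : R).

Lemma derive1_cderiv f z (l : C) : cderiv f z l -> derive1 f z = l.
Proof. by move=> /is_deriveP [_ <-]; rewrite derive1E. Qed.

Lemma derivable_cderiv f z : derivable f z 1 -> cderiv f z (derive1 f z).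
Proof. by move=> df; apply/is_deriveP; rewrite derive1E; split; [exact: df|]. Qed.

Lemma cderiv_derivable f z (l : C) : cderiv f z l -> derivable f z 1.
Proof. by move=> /is_deriveP []. Qed.

Lemma cderiv_shift f c w (l : C) : cderiv (fun w => f (c + w)) w l <-> cderiv f (c + w) l.
Proof.
split=> H e e0; have [t t0 K] := H e e0; exists t => // h /K; by rewrite addrA.
Qed.

(** The growth bound accompanies the expansion, since differentiating term by term relies on it. *)
Definition hasps f c r a := geobd a r /\ forall w, cabs w < r -> psum a w (f (c + w)).

Lemma hasps_sub f c r s a : 0 < s <= r -> hasps f c r a -> hasps f c s a.
Proof.
move=> /andP[s0 sr] [[M aM] fa]; split; last first.
  by move=> w ws; apply: fa; exact: lt_le_trans sr.
have M0 : 0 <= M by have := le_trans (cabs_ge0 _) (aM 0%N); rewrite expr0 divr1.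
exists M => n; rewrite (le_trans (aM n))// ler_wpM2l//.
rewrite lef_pV2 ?posrE ?exprn_gt0//; last exact: lt_le_trans sr.
by rewrite lerXn2r ?nnegrE ?(ltW s0)// (le_trans (ltW s0)).
Qed.

Lemma hasps_cderiv f c r a w : hasps f c r a -> cabs w < r ->
  exists2 l, psum (dcoef a) w l & cderiv f (c + w) l.
Proof.
move=> [ba fa] wr; have r0 := le_lt_trans (cabs_ge0 _) wr.
pose s := (cabs w + r) / 2; have [ws sr] : cabs w < s /\ s < r by rewrite /s; split; lra.
have s0 := le_lt_trans (cabs_ge0 _) ws.
have [l lP] := psum_ex (geobd_dcoef (introT andP (conj s0 sr)) ba) ws.
by exists l => //; apply/cderiv_shift; exact: psum_cderiv ba fa wr lP.
Qed.

Lemma hasps_derive1 f c r s a : 0 < s < r -> hasps f c r a ->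
  hasps (derive1 f) c s (dcoef a).
Proof.
move=> /andP[s0 sr] H; split; first by apply: geobd_dcoef H.1; rewrite s0.
move=> w ws; have [l al /derive1_cderiv ->//] := hasps_cderiv H (lt_trans ws sr).
Qed.

(** Each differentiation costs some radius; the induction passes through [(s + r) / 2]. *)
Lemma hasps_derive1n n f c r s a : 0 < s < r -> hasps f c r a ->
  hasps (derive1n n f) c s (iter n dcoef a).
Proof.
elim: n s => [|n IH] s /andP[s0 sr] H.
  by apply: hasps_sub H; rewrite s0 ltW.
rewrite derive1nS /=; apply: (@hasps_derive1 _ _ ((s + r) / 2)); first lra.
by apply: IH => //; lra.
Qed.

Lemma iter_dcoefE n a k : iter n dcoef a k = ((k + n) ^_ n)%:R * a (k + n)%N.
Proof.
elim: n k => [|n IH] k; first by rewrite addn0 ffactn0 mul1r.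
rewrite iterS {1}/dcoef IH addSnnS mulrA -natrM mulnC.
by congr (_%:R * _); rewrite ffactnSr addnS subSn ?leq_addl// addnK.
Qed.

(** At the centre, only the constant term of the [n] times derived series survives. *)
Lemma hasps_coef n f c r a : 0 < r -> hasps f c r a -> derive1n n f c = n`!%:R * a n.
Proof.
move=> r0 H; have r2 : 0 < r / 2 < r by lra.
have [_ /(_ 0)] := hasps_derive1n n r2 H; rewrite cabs0 => /(_ _)/psum_0.
by rewrite addr0 iter_dcoefE add0n ffactnn; apply; lra.
Qed.

(* The closed square of half-width [r] centred at [c] lies in the disc of radius
   [3 * r]. *)
Lemma taylor_disc f c r : 0 < r ->
  (forall z, cabs (z - c) < 3 * r -> exists d, cderiv f z d) ->
  exists2 a, hasps f c r a &
    forall M, (forall z, cabs (z - c) < 3 * r -> cabs (f z) <= M) ->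
    forall n, cabs (a n) <= 16 * M / r ^+ n.
Proof.
move=> r0 df; pose g w := f (c + w).
have insq w : inrect (- r) r (- r) r w -> cabs (c + w - c) < 3 * r.
  rewrite addrC addKr => /andP[/andP[? ?] /andP[? ?]].
  rewrite (le_lt_trans (cabs_le _))// (@le_lt_trans _ _ (r + r))//; last lra.
  by apply: lerD; rewrite ler_norml; lra.
have dg w : inrect (- r) r (- r) r w -> exists d, cderiv g w d.
  by move=> /insq /df [d ?]; exists d; apply/cderiv_shift.
have cg w : inrect (- r) r (- r) r w -> ccont g w.
  by move=> /dg [d]; exact: cderiv_cont.
have rr : - r < r by lra.
exists (ccoef r g).
  split; last by move=> w wr; exact: cauchy_series.
  have [M HM] := rect_bounded rr rr cg.
  by exists (16 * M) => n; apply: ccoef_bound => // z [? _]; [exact: cg|exact: HM].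
move=> M HM n; apply: ccoef_bound => // z [zin _]; first exact: cg.
exact/HM/insq.
Qed.

Lemma disc_open c r z : cabs (z - c) < r -> exists2 s, 0 < s &
  forall w, cabs (w - z) < s -> cabs (w - c) < r.
Proof.
move=> zr; exists (r - cabs (z - c)); first by rewrite subr_gt0.
move=> w wz; have := cabs_tri w z c; lra.
Qed.

Lemma disc_convex c r z w t : cabs (z - c) < r -> cabs (w - c) < r ->
  0 <= t <= 1 -> cabs (z + t%:C * (w - z) - c) < r.
Proof.
move=> zr wr /andP[t0 t1].
have -> : z + t%:C * (w - z) - c = (1 - t)%:C * (z - c) + t%:C * (w - c).
  by rewrite rmorphB rmorph1; ring.
rewrite (le_lt_trans (cabsD _ _))// !cabsM !cabs_real.
rewrite ger0_norm ?subr_ge0// ger0_norm//.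
have [->|tn0] := eqVneq t 0; first by rewrite mul0r subr0 mul1r addr0.
have tgt0 : 0 < t by rewrite lt_def tn0.
have : t * cabs (w - c) < t * r by rewrite ltr_pM2l.
have : (1 - t) * cabs (z - c) <= (1 - t) * r by rewrite ler_wpM2l ?subr_ge0// ltW.
lra.
Qed.

Lemma open_cabsP (A : set C) : open A <->
  forall z, A z -> exists2 r, 0 < r & forall w, cabs (w - z) < r -> A w.
Proof.
rewrite openE; split=> H z Az; first by have /nbhs_cabsP := H z Az.
by apply/nbhs_cabsP; exact: H.
Qed.

(** [f] has a Taylor expansion at each point of [A], and power series can be differentiated
    repeatedly. *)
Lemma holo_derive1n (A : set C) f n : open A -> holomorphic A f ->
  holomorphic A (derive1n n f).
Proof.
move=> /open_cabsP oA hf z /oA [r r0 rA].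
have r9 : 0 < r / 9 < r / 3 by lra.
have r3 : 0 < r / 3 by lra.
have [w wz|a af _] := @taylor_disc f z _ r3.
  exists (derive1 f w); apply: derivable_cderiv; apply: hf; apply: rA.
  by rewrite (lt_le_trans wz)//; lra.
have [|l _] := @hasps_cderiv _ _ _ _ 0 (hasps_derive1n n r9 af).
  by rewrite cabs0; lra.
by rewrite addr0; exact: cderiv_derivable.
Qed.

Lemma holo_cderivn (A : set C) f n z : open A -> holomorphic A f -> A z ->
  cderiv (derive1n n f) z (derive1n n.+1 f z).
Proof.
Proof.
move=> oA hf Az; rewrite derive1nS; apply: derivable_cderiv.
exact: holo_derive1n oA hf _ Az.
Qed.

(** The constants 16 and 3 are inherited from the square contour. *)
Lemma cauchy_estimate f c r M n : 0 < r ->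
  (forall z, cabs (z - c) < 3 * r -> derivable f z 1) ->
  (forall z, cabs (z - c) < 3 * r -> cabs (f z) <= M) ->
  cabs (derive1n n f c) <= n`!%:R * (16 * M / r ^+ n).
Proof.
move=> r0 df fM; have [z zr|a af /(_ M fM n) aM] := @taylor_disc f c r r0.
  by exists (derive1 f z); apply: derivable_cderiv; exact: df.
by rewrite (hasps_coef n r0 af) cabsM cabs_natr ler_wpM2l.
Qed.

Lemma near_derive1n f g z n : (\near z, f z = g z) -> derive1n n f z = derive1n n g z.
Proof.
suff H : (\forall w \near z, f w = g w) -> \forall w \near z, derive1n n f w = derive1n n g w.
  by move=> /H /nbhs_singleton.
elim: n f g => [//|n IH] f g fg; rewrite !derive1nS; have := IH _ _ fg.
move=> /nbhs_interior; apply: filterS => w fgw.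
by rewrite !derive1E; apply: near_eq_derive.
Qed.

End Taylor.

(** * Extendable functions and growth of Taylor coefficients *)

Section Extension.
Context {R : realType}.
Local Notation C := (R[i]^o).
Implicit Types (f g F S : C -> C) (a b : nat -> C) (z p w h c : C) (M r s t : R)
  (Omega : set C).

(** The constant [M] is a parameter: for fixed [M] the condition is closed in [f]. *)
Definition taylor_bound f c r M := forall n, cabs (derive1n n f c) <= n`!%:R * (M / r ^+ n).

Lemma natf_neq0 n : n`!%:R != 0 :> C.
Proof. by rewrite pnatr_eq0 -lt0n fact_gt0. Qed.

Lemma hasps_fun a c r : geobd a r ->
  exists g, hasps g c r a.
Proof.
move=> ba; exists (fun z => xget 0 [set l | psum a (z - c) l]); split=> // w wr.
rewrite addrC addKr; case: xgetP => [l -> //|N].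
by have [l /N] := psum_ex ba wr.
Qed.

(** The Taylor series of [f] at [c] converges in the disc of radius [r], which reaches [p] outside
    [Omega], and its sum agrees with [f] near [c]. *)
Lemma extendable_taylor_bound Omega f c r M p :
  open Omega -> holomorphic Omega f -> Omega c -> ~ Omega p -> cabs (p - c) < r ->
  taylor_bound f c r M -> extendable Omega f.
Proof.
move=> oO hf Oc Op pr fM.
have r0 : 0 < r := le_lt_trans (cabs_ge0 _) pr.
pose a n := n`!%:R^-1 * derive1n n f c.
have aE n : n`!%:R * a n = derive1n n f c.
  by rewrite /a mulrA mulfV ?natf_neq0 ?mul1r.
have ba : geobd a r.
  exists M => n; rewrite cabsM cabsV cabs_natr mulrC ler_pdivrMr ?ltr0n ?fact_gt0//.
  by rewrite mulrC.
have [g gP] := hasps_fun c ba.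
have [s s0 sO] := (open_cabsP Omega).1 oO c Oc.
have s3 : 0 < s / 3 by lra.
have [z zs|b fb _] := @taylor_disc _ f c _ s3.
  exists (derive1 f z); apply: derivable_cderiv; apply: hf; apply: sO.
  by rewrite (lt_le_trans zs)//; lra.
have ab : b = a.
  apply/funext => n; apply: (mulfI (natf_neq0 n)).
  by rewrite aE (hasps_coef n s3 fb).
rewrite {b}ab in fb.
(* The closure of the disc of radius [t] lies within [2 * t] of [c], hence in the larger disc and in
   [Omega]. *)
pose t := Num.min (s / 3) r / 3.
have m0 : 0 < Num.min (s / 3) r by rewrite lt_min s3.
have [t0 t1 t2] : [/\ 0 < t, 2 * t < s / 3 & 2 * t < r].
  have : Num.min (s / 3) r <= s / 3 by rewrite ge_min lexx.
  have : Num.min (s / 3) r <= r by rewrite ge_min lexx orbT.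
  by move: m0; rewrite /t => ? ? ?; split; lra.
exists c, c, t, r; split => //=.
- by exists c; split => //; apply/ball_cabs => //; rewrite subrr cabs0.
- by exists p; split => //; exact/ball_cabs.
- split; first exact: subset_closure.
  move=> z; have /[swap] /[apply] : nbhs z [set w | cabs (w - z) < t].
    by apply/nbhs_cabsP; exists t.
  move=> [w [/(ball_cabs _ _ t0) wc wz]].
  have zc : cabs (z - c) < 2 * t.
    by have := cabs_tri z w c; rewrite [cabs (z - w)]cabsC /=; move: wz; rewrite /=; lra.
  split; first by apply/ball_cabs => //; lra.
  by apply: sO; lra.
- exists g.
    move=> z /(ball_cabs _ _ r0) zr.
    have [l _] := hasps_cderiv gP zr; rewrite addrC subrK; exact: cderiv_derivable.
  move=> z /(ball_cabs _ _ t0) zt.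
  have := gP.2 (z - c) ltac:(lra); have := fb.2 (z - c) ltac:(lra).
  by rewrite [c + _]addrC subrK => fz gz; exact: psum_unique gz fz.
Qed.

Lemma rat_approx (x e : R) : 0 < e -> exists q : rat, `|ratr q - x| < e.
Proof.
move=> e0; have [|q] := @rat_in_itvoo R (x - e) (x + e); first by lra.
by rewrite in_itv/= => /andP[? ?]; exists q; rewrite ltr_norml; lra.
Qed.

Lemma near_disc_derive1n f g z r n : 0 < r -> (forall w, cabs (w - z) < r -> f w = g w) ->
  derive1n n f z = derive1n n g z.
Proof. by move=> r0 fg; apply: near_derive1n; apply/nbhs_cabsP; exists r. Qed.

Lemma derive1n_0 n z : derive1n n (fun=> 0 : C) z = 0.
Proof.
suff -> : derive1n n (fun=> 0 : C) = (fun=> 0 : C) by [].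
elim: n => // n IH; rewrite derive1nS IH; apply/funext => w.
exact: derive1_cderiv (cderiv_cst _ _).
Qed.

(** Vanishing near [c] kills all Taylor coefficients at [c], and the series represents [f] on the
    disc of radius [r]. *)
Lemma identity_disc f c r s : 0 < r -> 0 < s ->
  (forall z, cabs (z - c) < 3 * r -> exists d, cderiv f z d) ->
  (forall z, cabs (z - c) < s -> f z = 0) -> forall z, cabs (z - c) < r -> f z = 0.
Proof.
move=> r0 s0 df f0 z zr; have [a fa _] := taylor_disc r0 df.
have a0 n : a n = 0.
  apply: (mulfI (natf_neq0 n)).
  by rewrite mulr0 -(hasps_coef n r0 fa) (near_disc_derive1n n s0 f0) derive1n_0.
by have := fa.2 _ zr; rewrite [c + _]addrC subrK; exact: psum_eq0.
Qed.

(* Walking along a segment of the disc from a point near which [f = g] to a point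
   outside [Omega], one leaves [Omega] at some [p], and [f = g] holds near
   points arbitrarily close to [p]. *)
Lemma boundary_point Omega f g c r (c1 q : C) r1 :
  open Omega -> holomorphic Omega f -> (forall z, cabs (z - c) < r -> derivable g z 1) ->
  0 < r1 -> (forall z, cabs (z - c1) < r1 -> [/\ Omega z, cabs (z - c) < r & f z = g z]) ->
  cabs (q - c) < r -> ~ Omega q ->
  exists p, [/\ cabs (p - c) < r, ~ Omega p & forall e, 0 < e ->
    exists w s, [/\ 0 < s, cabs (w - p) < e &
       forall z, cabs (z - w) < s -> Omega z /\ f z = g z]].
Proof.
move=> oO hf dg r10 fg1 qr Oq.
pose P w := exists2 s, 0 < s &
  forall z, cabs (z - w) < s -> [/\ Omega z, cabs (z - c) < r & f z = g z].
pose h t := c1 + t%:C * (q - c1).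
pose L := cabs (q - c1) + 1; have L0 : 0 < L by rewrite ltr_wpDl// cabs_ge0.
have hd s t : cabs (h s - h t) <= `|s - t| * L.
  rewrite /h opprD addrACA subrr add0r -mulrBl -rmorphB/= cabsM cabs_real.
  by rewrite ler_wpM2l// /L lerDl.
(* [T] collects the parameters up to which [f = g] holds near every point of the segment; its
   supremum [t0] is the exit time. *)
pose T := [set t | 0 <= t <= 1 /\ forall s, 0 <= s <= t -> P (h s)].
have T0 : T 0.
  split; first by rewrite lexx ler01.
  move=> s s0; have -> : s = 0 by lra.
  by exists r1; rewrite // /h mul0r addr0.
have hsT : has_sup T.
  by split; [exists 0|exists 1 => t [/andP[]]].
pose t0 := sup T.
have t00 : 0 <= t0 by apply: ub_le_sup => //; case: hsT.
have t01 : t0 <= 1 by apply: ge_sup; [exists 0|move=> t [/andP[]]].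
have hD t : 0 <= t <= 1 -> cabs (h t - c) < r.
  by apply: disc_convex => //; have [] := fg1 c1; rewrite ?subrr ?cabs0.
have near e : 0 < e -> exists2 t, T t & t0 - e < t <= t0.
  move=> e0; have [t Tt te] := sup_adherent e0 hsT; exists t => //.
  by rewrite te; apply: ub_le_sup => //; case: hsT.
exists (h t0); split.
- by apply: hD; rewrite t00.
(* Were [h t0] in [Omega], the identity principle on a disc around a nearby [h t] with [t] in [T]
   would carry [T] beyond [t0], or up to the end point [q], which is outside [Omega]. *)
- move=> Op.
  have [s1 s10 H1] := (open_cabsP Omega).1 oO _ Op.
  have [s2 s20 H2] := disc_open (hD t0 ltac:(by rewrite t00)).
  pose s := Num.min s1 s2 / 4.
  have m0 : 0 < Num.min s1 s2 by rewrite lt_min s10.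
  have s0 : 0 < s by rewrite /s; lra.
  have Hs z : cabs (z - h t0) < 4 * s -> Omega z /\ cabs (z - c) < r.
    move=> zs; have : cabs (z - h t0) < Num.min s1 s2 by move: zs; rewrite /s; lra.
    by rewrite lt_min => /andP[/H1 ? /H2 ?].
  pose e := s / (4 * L); have e0 : 0 < e by rewrite divr_gt0// mulr_gt0.
  have eL : e * L = s / 4 by rewrite /e; field; rewrite gt_eqF.
  have [t Tt /andP[te tt0]] := near e e0.
  have htp : cabs (h t - h t0) < s.
    rewrite (le_lt_trans (hd _ _))// (@le_lt_trans _ _ (e * L))//; last lra.
    by rewrite ler_wpM2r ?(ltW L0)// ler_norml; lra.
  have in4 z : cabs (z - h t) < 3 * s -> cabs (z - h t0) < 4 * s.
    by move=> zs; have := cabs_tri z (h t) (h t0); lra.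
  have [s' s'0 Hs'] := Tt.2 t ltac:(by case/andP: Tt.1 => -> _; rewrite lexx).
  have fgt z : cabs (z - h t) < s -> [/\ Omega z, cabs (z - c) < r & f z = g z].
    move=> zs; have [] : Omega z /\ cabs (z - c) < r by apply/Hs/in4; lra.
    split=> //; apply/eqP; rewrite -subr_eq0; apply/eqP.
    apply: (@identity_disc (fun z => f z - g z) (h t) s s') => //.
      move=> w /in4 /Hs [Ow wr]; eexists; apply: cderivB; apply: derivable_cderiv.
        exact: hf.
      exact: dg.
    by move=> w /Hs' [_ _ ->]; rewrite subrr.
  pose t1 := Num.min 1 (t0 + e).
  have t11 : t1 <= 1 by rewrite /t1 ge_min lexx.
  have t1e : t1 <= t0 + e by rewrite /t1 ge_min lexx orbT.
  have Tt1 : T t1.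
    split; first by rewrite t11 andbT /t1 le_min ler01; lra.
    move=> u /andP[u0 ut1]; have [ut|tu] := leP u t; first by apply: Tt.2; rewrite u0.
    have hu : cabs (h u - h t) < s.
      rewrite (le_lt_trans (hd _ _))// (@le_lt_trans _ _ (2 * e * L))//; last first.
        by rewrite -mulrA eL; lra.
      by rewrite ler_wpM2r ?(ltW L0)// ler_norml; lra.
    by have [s3 s30 H3] := disc_open hu; exists s3 => // z /H3 /fgt.
  have t1t0 : t1 <= t0 by apply: ub_le_sup => //; case: hsT.
  have t1E : t1 = 1.
    have [h1|/ltW h1] := leP 1 (t0 + e); first exact/min_idPl.
    by exfalso; move: t1t0; rewrite /t1 (min_idPr h1) leNgt ltrDl e0.
  have [s3 s30 H3] := Tt1.2 1 ltac:(by rewrite t1E ler01 lexx).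
  have [] := H3 q => //.
  by rewrite /h mul1r [c1 + _]addrC subrK subrr cabs0.
- move=> e e0; have [t Tt /andP[te tt0]] := near (e / L) (divr_gt0 e0 L0).
  have [s s0 Hs] := Tt.2 t ltac:(by case/andP: Tt.1 => -> _; rewrite lexx).
  exists (h t), s; split => //; last by move=> z /Hs [].
  rewrite (le_lt_trans (hd _ _))// -ltr_pdivlMr// ltr_norml; lra.
Qed.

Definition rat_point (k : rat * rat) : C := ratr k.1 +i* ratr k.2.

Lemma extendable_taylor Omega f : open Omega -> holomorphic Omega f ->
  extendable Omega f -> exists k (r : rat), [/\ Omega (rat_point k),
    exists2 p, ~ Omega p & cabs (p - rat_point k) < ratr r &
    exists M, taylor_bound f (rat_point k) (ratr r) M].
Proof.
move=> oO hf [c1 [c [r1 [r [[r10 r0] _ [q [/(ball_cabs _ _ r0) qr Oq]] [_ cD1]] [g hg gf]]]]].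
have gf' z : cabs (z - c1) < r1 -> [/\ Omega z, cabs (z - c) < r & f z = g z].
  move=> /(ball_cabs _ _ r10) zr.
  by have [/(ball_cabs _ _ r0) ? ?] := cD1 _ (subset_closure zr); split=> //; rewrite gf.
have dg z : cabs (z - c) < r -> derivable g z 1 by move=> zr; apply: hg; apply/ball_cabs.
have [p [pr Op H]] := boundary_point oO hf dg r10 gf' qr Oq.
have [s s0 Hs] := disc_open pr.
(* The rational point will lie within [e] of [p], and [e < m < 2 * e]. So its disc of radius [m]
   contains [p], while the disc of radius [3 * m] needed by [taylor_disc] stays within [7 * e < s]
   of [p], where [g] is holomorphic. *)
pose e := s / 9; have e0 : 0 < e by rewrite /e; lra.
have [w [t [t0 wp Ht]]] := H e e0.
pose u := Num.min t (e - cabs (w - p)).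
have u0 : 0 < u by rewrite /u lt_min t0 subr_gt0.
have u2 : 0 < u / 3 by lra.
have [k1 Hk1] := rat_approx (complex.Re w) u2.
have [k2 Hk2] := rat_approx (complex.Im w) u2.
have kw : cabs (rat_point (k1, k2) - w) < u.
  by rewrite (le_lt_trans (cabs_le _))// cReB cImB /=; lra.
have [kt kp] : cabs (rat_point (k1, k2) - w) < t /\ cabs (rat_point (k1, k2) - p) < e.
  have := cabs_tri (rat_point (k1, k2)) w p.
  by move: kw; rewrite /u lt_min => /andP[? ?] ?; split=> //; lra.
have [|m] := @rat_in_itvoo R e (2 * e); first lra.
rewrite in_itv/= => /andP[em me].
have m0 : 0 < ratr m :> R by lra.
exists (k1, k2), m; split.
- by case: (Ht _ kt).
- by exists p => //; rewrite cabsC; lra.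
- have [z zm|a ga _] := @taylor_disc _ g (rat_point (k1, k2)) _ m0.
    exists (derive1 g z); apply: derivable_cderiv; apply: dg; apply: Hs.
    by have := cabs_tri z (rat_point (k1, k2)) p; rewrite /e in e0 em me kp *; lra.
  have [[M aM] _] := ga; exists M => n.
  have [v v0 Hv] := disc_open kt.
  have -> : derive1n n f (rat_point (k1, k2)) = derive1n n g (rat_point (k1, k2)).
    by apply: near_disc_derive1n v0 _ => y /Hv /Ht [].
  by rewrite (hasps_coef n m0 ga) cabsM cabs_natr ler_wpM2l.
Qed.

End Extension.

(** * The natural topology *)

Section SeminormTopology.
Context {R : realType} {V : zmodType} {A : set V} {P : set (V -> R)}.

Lemma seminorm_spaceP (U : set (seminorm_space A P)) : open U <-> seminorm_open U.
Proof. by []. Qed.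

End SeminormTopology.

Section NaturalTopology.
Context {R : realType}.
Local Notation C := (R[i]^o).
Implicit Types (f g h : C -> C) (z w c : C) (M r s t e : R)
  (Omega : set C) (F : set nat).

Lemma derive1n_lin Omega f g (k : C) n w : open Omega ->
  holomorphic Omega f -> holomorphic Omega g -> Omega w ->
  derive1n n (fun z => f z + k * g z) w = derive1n n f w + k * derive1n n g w.
Proof.
move=> oO hf hg; elim: n w => [//|n IH] w Ow.
have [s s0 sO] := (open_cabsP Omega).1 oO w Ow.
have D := cderivD (holo_cderivn n oO hf Ow)
  (cderivM (cderiv_cst k w) (holo_cderivn n oO hg Ow)).
have E := @near_disc_derive1n R (derive1n n (fun z => f z + k * g z))
  (fun z => derive1n n f z + k * derive1n n g z) w s 1 s0.
rewrite !derive1n1 in E; rewrite derive1nS E ?(derive1_cderiv D) ?mulr0 ?addr0//.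
by move=> z /sO Oz; exact: IH.
Qed.

Lemma HFinf_bounded Omega F f l : HFinf Omega F f -> F l ->
  exists M, forall z, Omega z -> cabs (derive1n l f z) <= M.
Proof.
move=> [_ + _] => /[apply] -[M [Mr HM]].
have {}Mr : M = (complex.Re M)%:C by rewrite RRe_real.
exists (complex.Re M + 1) => z Oz; rewrite -lecR -normE; apply: HM => //.
by rewrite Mr ltcR ltrDl.
Qed.

Lemma HFinf_lin Omega F f g (k : C) : open Omega -> HFinf Omega F f -> HFinf Omega F g ->
  HFinf Omega F (fun z => f z + k * g z).
Proof.
move=> oO Hf Hg; have [hf _ f0] := Hf; have [hg _ g0] := Hg; split.
- move=> z Oz; have Df := holo_cderivn 0 oO hf Oz; have Dg := holo_cderivn 0 oO hg Oz.
  exact: cderiv_derivable (cderivD Df (cderivM (cderiv_cst k z) Dg)).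
- move=> l Fl; have [M HM] := HFinf_bounded Hf Fl; have [N HN] := HFinf_bounded Hg Fl.
  exists (M + cabs k * N)%:C; split; first by apply/complex_realP; eexists.
  move=> x Mx z Oz /=; rewrite (derive1n_lin _ _ oO)//.
  apply: (le_trans _ (ltW Mx)); rewrite normE lecR.
  by rewrite (le_trans (cabsD _ _))// lerD ?HM// cabsM ler_wpM2l ?cabs_ge0// HN.
- by move=> z Oz; rewrite f0// g0// mulr0 addr0.
Qed.

Lemma HFinf_sub Omega F f g : open Omega -> HFinf Omega F f -> HFinf Omega F g ->
  HFinf Omega F (f - g).
Proof.
move=> oO Hf Hg; have -> : f - g = (fun z => f z + (-1) * g z).
  by apply/funext => z; rewrite mulN1r.
exact: HFinf_lin.
Qed.

Lemma derive1n_sub Omega f g n w : open Omega ->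
  holomorphic Omega f -> holomorphic Omega g -> Omega w ->
  derive1n n (f - g) w = derive1n n f w - derive1n n g w.
Proof.
move=> oO Hf Hg Ow; have -> : f - g = (fun z => f z + (-1) * g z).
  by apply/funext => z; rewrite mulN1r.
by rewrite (derive1n_lin _ _ oO)// mulN1r.
Qed.

Lemma sup_seminorm_ge Omega F f l z : HFinf Omega F f -> F l -> Omega z ->
  cabs (derive1n l f z) <= sup_seminorm Omega l f.
Proof.
move=> Hf Fl Oz; have [M HM] := HFinf_bounded Hf Fl.
apply: ub_le_sup; last by exists z.
by exists M => _ [w Ow <-]; exact: HM.
Qed.

(** The hypothesis [0 <= K] serves the case of an empty [Omega], where the supremum is 0. *)
Lemma sup_seminorm_le Omega f l K : 0 <= K ->
  (forall z, Omega z -> cabs (derive1n l f z) <= K) -> sup_seminorm Omega l f <= K.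
Proof.
move=> K0 HK; have [E0|/set0P[z Oz]] := eqVneq Omega set0.
  by rewrite /sup_seminorm E0 image_set0 sup0.
apply: ge_sup; first by exists (cabs (derive1n l f z)), z.
by move=> _ [w Ow <-]; exact: HK.
Qed.

Lemma min_setP F : F !=set0 -> F (min_set F) /\ forall k, F k -> (min_set F <= k)%N.
Proof.
move=> [n Fn]; rewrite /min_set; case: xgetP => [m -> //|].
have ex : exists k, `[< F k >] by exists n; exact/asboolP.
have [m /asboolP Fm mmin] := ex_minnP ex.
by move=> /(_ m) []; split=> // k Fk; apply: mmin; exact/asboolP.
Qed.

(** The mean value inequality, by integrating the derivative along the segment; the factor 2 is that
    of [cint_bound]. *)
Lemma cderiv_segment_le f (f' : C -> C) c r K z w :
  (forall v, cabs (v - c) < r -> cderiv f v (f' v)) ->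
  (forall v, cabs (v - c) < r -> ccont f' v) ->
  (forall v, cabs (v - c) < r -> cabs (f' v) <= K) ->
  cabs (z - c) < r -> cabs (w - c) < r -> cabs (f w - f z) <= 2 * K * cabs (w - z).
Proof.
move=> df cf' f'K zr wr.
have seg t : 0 <= t <= 1 -> cabs (z + t%:C * (w - z) - c) < r.
  exact: disc_convex.
pose L := cabs (w - z) + 1; have L0 : 0 < L by rewrite ltr_wpDl// cabs_ge0.
have cc : cconti 0 1 (fun t => (w - z) * f' (z + t%:C * (w - z))).
  move=> t t01 e e0; have [d d0 H] := cf' _ (seg t t01) (e / L) (divr_gt0 e0 L0).
  exists (d / L); first by rewrite divr_gt0.
  move=> s sd; rewrite -mulrBr cabsM.
  have := H (z + s%:C * (w - z)).
  rewrite opprD addrACA subrr add0r -mulrBl -rmorphB/= cabsM cabs_real => H'.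
  have hL : cabs (w - z) <= L by rewrite /L lerDl.
  have dl : `|s - t| * cabs (w - z) < d.
    by rewrite (le_lt_trans (ler_wpM2l (normr_ge0 _) hL))// -ltr_pdivlMr.
  rewrite (le_lt_trans (ler_wpM2r (cabs_ge0 _) hL))// mulrC -ltr_pdivlMr//.
  exact: H'.
have : cint 0 1 (fun t => (w - z) * f' (z + t%:C * (w - z))) =
    f (z + 1%:C * (w - z)) - f (z + 0%:C * (w - z)).
  apply: cint_prim => // t t01; exists (f' (z + t%:C * (w - z))).
    exact: df (seg t t01).
  by rewrite mulrC.
rewrite mul1r mul0r addr0 [z + _]addrC subrK => <-.
have -> : 2 * K * cabs (w - z) = 2 * (cabs (w - z) * K) * (1 - 0) by ring.
by apply: cint_bound => // t t01; rewrite cabsM ler_wpM2l ?cabs_ge0// f'K// seg.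
Qed.

(** * Continuity of the evaluations of derivatives *)

Section continuity.
Variables (Omega : set C) (F I : set nat) (zi : nat -> C).
Hypotheses (oO : open Omega) (F0 : F !=set0).
Local Notation A := (HFinf Omega F).
Local Notation P := (natural_seminorms Omega F I zi).

(* Continuity at [0] of [h |-> derive1n n h w] for the natural topology,
   uniformly in [w \in X]. *)
Definition small_on (X : set C) n := forall d, 0 < d ->
  exists (J : set ((C -> C) -> R)) e, [/\ finite_set J, J `<=` P, 0 < e &
    forall h, A h -> (forall p, J p -> p h < e) -> forall w, X w -> cabs (derive1n n h w) < d].

Lemma small_sup l : F l -> small_on Omega l.
Proof.
move=> Fl d d0; exists [set sup_seminorm Omega l], d; split => //.
- by move=> _ ->; left; exists l.
- by move=> h Ah /(_ _ erefl) hd w Ow; exact: le_lt_trans (sup_seminorm_ge Ah Fl Ow) hd.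
Qed.

(** The derivative of order [m = min_set F] is controlled on all of [Omega], and Cauchy's estimate
    for its derivative of order [n - m], with constant [B], controls order [n] at [c]. *)
Lemma small_high n c : (min_set F <= n)%N -> Omega c -> small_on [set c] n.
Proof.
move=> mn Oc d d0; have [Fm _] := min_setP F0; set m := min_set F in mn Fm.
have [s s0 sO] := (open_cabsP Omega).1 oO c Oc.
have s3 : 0 < s / 3 by lra.
pose B := (n - m)`!%:R * (16 / (s / 3) ^+ (n - m)).
have B0 : 0 < B.
  by rewrite mulr_gt0 ?ltr0n ?fact_gt0// divr_gt0// exprn_gt0.
have [J [e [fJ JP e0 HJ]]] := small_sup Fm (divr_gt0 (divr_gt0 d0 (ltr0Sn _ 1)) B0).
exists J, e; split=> // h Ah Jh _ ->.
have hd := HJ h Ah Jh; have [hh _ _] := Ah.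
have s3E z : cabs (z - c) < 3 * (s / 3) -> Omega z.
  by move=> zs; apply: sO; rewrite (lt_le_trans zs)//; lra.
have -> : derive1n n h c = derive1n (n - m) (derive1n m h) c.
  by rewrite /derive1n -iterD subnK.
rewrite (@le_lt_trans _ _ (d / 2))//; last lra.
have := @cauchy_estimate _ (derive1n m h) c (s / 3) (d / 2 / B) (n - m)%N s3 _ _.
have -> : (n - m)`!%:R * (16 * (d / 2 / B) / (s / 3) ^+ (n - m)) = B * (d / 2 / B).
  by rewrite /B; ring.
have -> : B * (d / 2 / B) = d / 2 by clearbody B; field; rewrite gt_eqF.
apply.
- by move=> z /s3E; exact: holo_derive1n.
- by move=> z /s3E /hd /ltW.
Qed.

Lemma small_point n i : (n < min_set F)%N -> I i -> small_on [set zi i] n.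
Proof.
move=> nm Ii d d0; exists [set point_seminorm (zi i) n], d; split => //.
- by move=> _ ->; right; exists n, i.
- by move=> h _ /(_ _ erefl) ? _ ->.
Qed.

(** Integrating from [w] combines control of order [n.+1] on the disc with control of order [n] at
    the single point [w]. *)
Lemma small_spread n c r w : 0 < r -> (forall z, cabs (z - c) < r -> Omega z) ->
  small_on [set z | cabs (z - c) < r] n.+1 -> cabs (w - c) < r -> small_on [set w] n ->
  small_on [set z | cabs (z - c) < r] n.
Proof.
move=> r0 rO Sn wr Sw d d0.
have d2 : 0 < d / 2 by lra.
(* Points of the disc are at distance at most [2 * r], so the mean value inequality gives
   [2 * (d / (8 * r)) * (2 * r) = d / 2]. *)
have [J [e [fJ JP e0 HJ]]] := Sn (d / (8 * r)) ltac:(by rewrite divr_gt0// mulr_gt0).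
have [J' [e' [fJ' JP' e'0 HJ']]] := Sw _ d2.
exists (J `|` J'), (Num.min e e'); split.
- by rewrite finite_setU.
- by move=> p [/JP|/JP'].
- by rewrite lt_min e0.
move=> h Ah Hh v vr; have [hh _ _] := Ah.
have [h1 h2] : (forall p, J p -> p h < e) /\ (forall p, J' p -> p h < e').
  split=> p Jp; first by have := Hh p (or_introl Jp); rewrite lt_min => /andP[].
  by have := Hh p (or_intror Jp); rewrite lt_min => /andP[].
move: h1 h2 => /(HJ h Ah) h1 /(HJ' h Ah) h2.
have := @cderiv_segment_le (derive1n n h) (derive1n n.+1 h) c r (d / (8 * r)) w v _ _ _ wr vr.
move=> /(_ (fun z zr => holo_cderivn n oO hh (rO z zr))).
move=> /(_ (fun z zr => cderiv_cont (holo_cderivn n.+1 oO hh (rO z zr)))).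
move=> /(_ (fun z zr => ltW (h1 z zr))).
have vw : cabs (v - w) <= 2 * r.
  have := cabs_tri v c w; rewrite [cabs (c - w)]cabsC; move: vr; rewrite /=; lra.
have : 2 * (d / (8 * r)) * cabs (v - w) <= 2 * (d / (8 * r)) * (2 * r).
  by rewrite ler_wpM2l// mulr_ge0// divr_ge0 ?mulr_ge0// ltW.
have -> : 2 * (d / (8 * r)) * (2 * r) = d / 2 by field; rewrite gt_eqF.
have := h2 w erefl; have := cabsBl (derive1n n h v) (derive1n n h w); lra.
Qed.

Lemma small_sub (X Y : set C) n : X `<=` Y -> small_on Y n -> small_on X n.
Proof.
move=> XY H d /H [J [e [? ? ? K]]]; exists J, e; split=> // h Ah Jh w /XY.
exact: K.
Qed.

Variable (Omega_ : nat -> set C).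
Hypotheses (cO : components Omega I Omega_) (Oz : forall i, I i -> Omega_ i (zi i)).

(** Descending induction on [n] from [min_set F], where the sup seminorm controls the whole of
    [Omega]. Within a component, the points where order [n] is controlled include [zi i] and form an
    open and closed subset by [small_spread], hence the whole component. *)
Lemma small_disc n c : (n <= min_set F)%N -> Omega c ->
  exists r, [/\ 0 < r, (forall z, cabs (z - c) < r -> Omega z) &
    small_on [set z | cabs (z - c) < r] n].
Proof.
move=> nm; have [k] := ubnP (min_set F - n)%N; elim: k n nm c => // k IH n nm c kn Oc.
move: nm; rewrite leq_eqVlt => /predU1P[nE|nm].
  have [r r0 rO] := (open_cabsP Omega).1 oO c Oc.
  exists r; split=> //; apply: (small_sub rO); rewrite nE; apply: small_sup.
  by case: (min_setP F0).
have {}IH x : Omega x -> exists r, [/\ 0 < r, (forall z, cabs (z - x) < r -> Omega z) &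
    small_on [set z | cabs (z - x) < r] n.+1].
  by apply: IH => //; lia.
have step x : Omega x -> exists r, [/\ 0 < r, (forall z, cabs (z - x) < r -> Omega z) &
    forall y, cabs (y - x) < r -> small_on [set y] n -> small_on [set z | cabs (z - x) < r] n].
  move=> /IH [r [r0 rO rS]]; exists r; split=> // y yr; exact: small_spread.
have [i Ii iE] : exists2 i, I i & Omega_ i = connected_component Omega c.
  have [_ [_ _ sur]] := cO.
  by have [i Ii <-] := sur (connected_component Omega c) (ex_intro2 _ _ c Oc erefl); exists i.
pose B := connected_component Omega c `&` [set x | Omega x /\ small_on [set x] n].
suff BE : B = connected_component Omega c.
  have [_ Sc] : Omega c /\ small_on [set c] n.
    by have [] : B c by rewrite BE; exact: connected_component_refl.
  have [r [r0 rO rS]] := step c Oc; exists r; split=> //; apply: (rS c) => //.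
  by rewrite subrr cabs0.
apply: (@component_connected _ Omega c).
- exists (zi i); split; first by rewrite -iE; exact: Oz.
  split; last exact: small_point.
  by apply: (@connected_component_sub _ Omega c); rewrite -iE; exact: Oz.
- eexists; last by [].
  apply/open_cabsP => x [Ox Sx]; have [r [r0 rO rS]] := step x Ox.
  exists r => // y yr; split; first exact: rO.
  have := rS x _ Sx; rewrite subrr cabs0 => /(_ r0); apply: small_sub.
  by move=> _ ->.
(* The uncontrolled points form an open set: one controlled point in the disc around [x] would make
   [x] controlled as well. *)
- exists (~` [set x | Omega x /\ ~ small_on [set x] n]).
    apply: open_closedC; apply/open_cabsP => x [Ox Sx]; have [r [r0 rO rS]] := step x Ox.
    exists r => // y yr; split; first exact: rO.
    move=> Sy; apply: Sx; have := rS y yr Sy; apply: small_sub.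
    by move=> _ -> /=; rewrite subrr cabs0.
  apply/seteqP; split => x [cx].
    by move=> [Ox Sx]; split=> // -[_].
  have Ox := connected_component_sub cx.
  by move=> N; split=> //; split=> //; apply: contrapT => Sx; apply: N.
Qed.

Lemma small_all n c : Omega c -> small_on [set c] n.
Proof.
move=> Oc; have [|/ltnW nm] := leqP (min_set F) n; first by move=> ?; exact: small_high.
have [r [r0 _]] := small_disc nm Oc; apply: small_sub => _ -> /=.
by rewrite subrr cabs0.
Qed.

End continuity.
End NaturalTopology.

(** * Density and the G-delta property *)

Section Category.
Context {R : realType}.
Local Notation C := (R[i]^o).
Variables (Omega : set C) (F I : set nat) (Omega_ : nat -> set C) (zi : nat -> C).
Hypotheses (oO : open Omega) (F0 : F !=set0) (cO : components Omega I Omega_).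
Hypothesis Oz : forall i, I i -> Omega_ i (zi i).
Local Notation T := (HFinf_space Omega F I zi).
Local Notation P := (natural_seminorms Omega F I zi).
Let fn (f : T) : C -> C := \val (f : set_type (HFinf Omega F)).

Let fnP (f : T) : HFinf Omega F (fn f).
Proof. by rewrite /fn; case: f => g /= /set_mem. Qed.

Let ofn (f : C -> C) (Hf : HFinf Omega F f) : T := SigSub (mem_set Hf).

(** A violation is a strict inequality for a single [n], and it persists under small changes of the
    [n]-th derivative at [c]. *)
Lemma open_not_taylor_bound c r M : Omega c ->
  open (~` [set f : T | taylor_bound (fn f) c r M]).
Proof.
move=> Oc; apply/seminorm_spaceP => f /existsNP [n /negP]; rewrite -ltNge.
set K := _ * _; rewrite -subr_gt0 => fK.
have [J [e [fJ JP e0 H]]] := small_all oO F0 cO Oz n Oc fK.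
exists J, e; split=> // g Jg /(_ n); rewrite -/K leNgt => /negP; apply.
have [hf _ _] := fnP f; have [hg _ _] := fnP g.
have := H _ (HFinf_sub oO (fnP g) (fnP f)) Jg c erefl.
rewrite (derive1n_sub _ oO hg hf Oc) cabsC.
by have := cabsBl (derive1n n (fn f) c) (derive1n n (fn g) c); lra.
Qed.

Lemma point_in i : I i -> Omega (zi i).
Proof.
move=> Ii; have [fI _ _] := cO.2; have [c Oc cE] := fI i Ii.
by apply: (@connected_component_sub _ Omega c); rewrite cE; exact: Oz.
Qed.

Lemma derive1n_scale f (k : C) n w : holomorphic Omega f -> Omega w ->
  derive1n n (fun z => k * f z) w = k * derive1n n f w.
Proof.
move=> hf Ow; have h0 : holomorphic Omega (fun=> 0 : C).
  by move=> z _; exact: cderiv_derivable (cderiv_cst 0 z).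
have -> : (fun z => k * f z) = (fun z => 0 + k * f z) by apply/funext => z; rewrite add0r.
by rewrite (derive1n_lin _ _ oO h0 hf Ow) derive1n_0 add0r.
Qed.

Lemma seminorm_scale p f : P p -> HFinf Omega F f ->
  exists2 K, 0 < K & forall t, 0 < t -> p (fun z => t%:C * f z) < t * K.
Proof.
move=> Pp Hf; have [hf _ _] := Hf; case: Pp => [[l Fl <-]|[l [i [_ Ii ->]]]].
  have [M HM] := HFinf_bounded Hf Fl.
  exists (`|M| + 1) => [|t t0]; first by rewrite ltr_wpDl.
  apply: (@le_lt_trans _ _ (t * `|M|)); last by rewrite ltr_pM2l// ltrDl.
  apply: sup_seminorm_le => [|w Ow]; first by rewrite mulr_ge0// ltW.
  rewrite derive1n_scale// cabsM cabs_real gtr0_norm// ler_pM2l//.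
  by rewrite (le_trans (HM w Ow))// ler_norm.
exists (cabs (derive1n l f (zi i)) + 1) => [|t t0]; first by rewrite ltr_wpDl// cabs_ge0.
rewrite /point_seminorm -/(cabs _) derive1n_scale//; last exact: point_in.
by rewrite cabsM cabs_real gtr0_norm// ltr_pM2l// ltrDl.
Qed.

(** Keeps [f + t f0] in a given neighbourhood of [f] for all small [t > 0]. *)
Lemma finite_seminorm_scale (J : set ((C -> C) -> R)) f e :
  finite_set J -> J `<=` P -> HFinf Omega F f -> 0 < e ->
  exists2 d, 0 < d &
    forall t, 0 < t < d -> forall p, J p -> p (fun z => t%:C * f z) < e.
Proof.
move=> /finite_seqP [s ->] + Hf e0.
elim: s => [|p s IH] sP; first by exists 1.
have [|d d0 Hd] := IH; first by move=> q /= qs; apply: sP; rewrite /= inE qs orbT.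
have [|K K0 HK] := @seminorm_scale p f _ Hf; first by apply: sP; rewrite /= inE eqxx.
exists (Num.min d (e / K)); first by rewrite lt_min d0 divr_gt0.
move=> t; rewrite lt_min => /and3P[t0 td tK] q; rewrite /= inE => /predU1P[->|qs].
  by rewrite (lt_le_trans (HK t t0))// ltW// -ltr_pdivlMr.
by apply: Hd => //; rewrite t0.
Qed.

(** An injection into [nat] would make the interval countable, hence null, whereas its Lebesgue
    measure is [d]. *)
Lemma itv_noninjective (d : R) (k : R -> nat) : 0 < d ->
  exists s t, [/\ 0 < s < d, 0 < t < d, s != t & k s = k t].
Proof.
move=> d0; apply: contrapT => N.
have : countable `]0, d[%classic.
  apply/countable_injP; exists k => s t; rewrite !inE /= !in_itv /= => s01 t01 kst.
  by apply: contrapT => /eqP st; apply: N; exists s, t.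
move=> /countable_lebesgue_measure0; rewrite lebesgue_measure_itv /= lte_fin d0.
by rewrite oppr0 adde0 => -[] /eqP; rewrite gt_eqF.
Qed.

Lemma nonextendable_dense : nonextendable_set Omega F I zi !=set0 ->
  dense (nonextendable_set Omega F I zi).
Proof.
move=> [f0 Nf0] U [f Uf] /seminorm_spaceP /(_ f Uf) [J [e [fJ JP e0 HU]]].
have [d d0 Hd] := finite_seminorm_scale fJ JP (fnP f0) e0.
pose g t : C -> C := fun z => fn f z + t%:C * fn f0 z.
have Hg t : HFinf Omega F (g t) by exact: HFinf_lin.
apply: contrapT => NU.
have ext t : 0 < t < d -> extendable Omega (g t).
  move=> td; apply: contrapT => Ng; apply: NU; exists (ofn (Hg t)); split => //.
  apply: HU => p Jp; have -> : val (ofn (Hg t)) - val f = (fun z => t%:C * fn f0 z).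
    by apply/funext => z; rewrite /= /g /fn -[LHS]/(_ - _) addrC addKr.
  exact: Hd.
pose Q t (k : (rat * rat) * rat) := [/\ Omega (rat_point k.1),
   exists2 p, ~ Omega p & cabs (p - rat_point k.1) < ratr k.2 &
   exists M, taylor_bound (g t) (rat_point k.1) (ratr k.2) M].
have Qex t : 0 < t < d -> exists k, Q t k.
  move=> /ext /(extendable_taylor oO) [|k [r kr]]; first by case: (Hg t).
  by exists (k, r).
pose k t := xget ((0, 0), 0) [set k | Q t k].
have Qk t : 0 < t < d -> Q t (k t).
  by move=> /Qex [l Ql]; rewrite /k; case: xgetP => [? _ //|/(_ l)].
(* There are countably many rational discs for uncountably many parameters, so two of them share a
   disc. *)
have [s [t [sd td st kst]]] := itv_noninjective (pickle \o k) d0.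
have {}kst : k s = k t by apply: (pcan_inj pickleK).
have [Oc [p Op pr] [M HM]] := Qk s sd; have [_ _ [N HN]] := Qk t td.
move: Oc pr HM HN; rewrite kst; set c := rat_point _; set r := ratr _ => Oc pr HM HN.
have [hf _ _] := fnP f; have [h0 _ _] := fnP f0.
(* As [g s - g t = (s - t) f0], the bounds [M] and [N] for [g s] and [g t] combine into this one for
   [f0]. *)
apply: Nf0; apply: (@extendable_taylor_bound _ Omega (fn f0) c r ((M + N) / `|s - t|) p) => //.
move=> n; have st0 : 0 < `|s - t| by rewrite normr_gt0 subr_eq0.
have := HM n; have := HN n; rewrite !(derive1n_lin _ _ oO hf h0 Oc) => BN BM.
set D := derive1n n (fn f0) c in BM BN *.
rewrite -(ler_pM2l st0) -cabs_real -cabsM.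
have -> : (s - t)%:C * D = (derive1n n (fn f) c + s%:C * D) - (derive1n n (fn f) c + t%:C * D).
  by rewrite rmorphB /=; ring.
rewrite cabs_real; have -> : `|s - t| * (n`!%:R * ((M + N) / `|s - t| / r ^+ n)) =
   n`!%:R * (M / r ^+ n) + n`!%:R * (N / r ^+ n).
  have rn : r ^+ n != 0.
    by rewrite expf_neq0// gt_eqF// (le_lt_trans _ pr)// cabs_ge0.
  by field; rewrite rn gt_eqF.
by rewrite (le_trans (cabsB _ _))// lerD.
Qed.

Lemma nonextendable_Gdelta : Gdelta (nonextendable_set Omega F I zi).
Proof.
pose ok (k : (rat * rat) * rat) := Omega (rat_point k.1) /\
  exists2 p, ~ Omega p & cabs (p - rat_point k.1) < ratr k.2.
(* The constants run over natural numbers to keep the family countable; discs that are not [ok]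
   impose no condition. *)
pose B (k : ((rat * rat) * rat) * nat) : set T :=
  [set f | ok k.1 -> ~ taylor_bound (fn f) (rat_point k.1.1) (ratr k.1.2) k.2%:R].
(* Numbers that code no quadruple contribute the whole space. *)
pose G i := if unpickle i is Some k then B k else setT.
exists G.
  move=> i; rewrite /G; case: unpickle => [k|]; last exact: openT.
  have [okk|nok] := pselect (ok k.1); last first.
    have -> : B k = setT by apply/seteqP; split => // f _ /nok.
    exact: openT.
  have -> : B k = ~` [set f : T | taylor_bound (fn f) (rat_point k.1.1) (ratr k.1.2) k.2%:R].
    by apply/seteqP; split => [f /(_ okk)//|f Nf _].
  by apply: open_not_taylor_bound; case: okk.
apply/seteqP; split=> f.
  move=> Nf i _; rewrite /G; case: unpickle => [k [Oc [p Op pr]]|//] H; apply: Nf.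
  have [hf _ _] := fnP f.
  exact: extendable_taylor_bound oO hf Oc Op pr H.
move=> Bf /(extendable_taylor oO) [|k [r [Oc [p Op pr] [M HM]]]]; first by case: (fnP f).
(* A natural number above [M] makes the bound one of those excluded by the sets [B]. *)
pose m := Num.bound `|M|; have : forall i, G i f by move=> i; exact: Bf i Logic.I.
move=> {Bf} /(_ (pickle ((k, r), m))); rewrite /G pickleK; apply; first by split => //; exists p.
move=> n; apply: (le_trans (HM n)); rewrite ler_wpM2l// ler_wpM2r//.
  by rewrite invr_ge0 exprn_ge0// (le_trans _ (ltW pr))// cabs_ge0.
by rewrite (le_trans (ler_norm M))// ltW// archi_boundP.
Qed.

End Category.

Theorem theorem6p2 (R : realType) (Omega : set R[i]^o) (F : set nat)
  (I : set nat) (Omega_ : nat -> set R[i]^o) (z : nat -> R[i]^o) :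
  open Omega -> F !=set0 ->
  components Omega I Omega_ -> (forall i, I i -> Omega_ i (z i)) ->
  nonextendable_set Omega F I z = set0 \/
  (dense (nonextendable_set Omega F I z) /\
   Gdelta (nonextendable_set Omega F I z)).
Proof.
move=> oO F0 cO Oz; have [|/set0P S0] := eqVneq (nonextendable_set Omega F I z) set0.
  by left.
right; split; last exact: nonextendable_Gdelta oO F0 cO Oz.
exact: nonextendable_dense oO cO Oz S0.
Qed.
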